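(* Put $\theta_1:=1/d_N$, $\theta_2:=N/d_N^2$, $\theta_3:=N^2/d_N^3$. Let $\{\alpha_N\}_{N\ge1}$ be a sequence of positive real numbers and let $x\in S_\star$, with $i\in\llbracket1,\kappa_2\rrbracket$ and $j\in\llbracket1,\kappa_3\rrbracket$ such that $\{x\}\subseteq S_{\star i}^2\subseteq S_{\star j}^3$. (1) If $\alpha_N\ll\theta_1$, then $\lim_{N\to\infty}\mathbb P_{\xi^x}[\eta_N(\alpha_N)=\xi^x]=1$. (2) If $\theta_1\ll\alpha_N\ll\theta_2$, then $\lim_{N\to\infty}\mathbb P_{\xi^x}[\eta_N(\alpha_N)=\xi^y]=|S_{\star i}^2|^{-1}$ for all $y\in S_{\star i}^2$. (3) If $\theta_2\ll\alpha_N\ll\theta_3$, then $\lim_{N\to\infty}\mathbb P_{\xi^x}[\eta_N(\alpha_N)=\xi^y]=|S_{\star j}^3|^{-1}$ for all $y\in S_{\star j}^3$. (4) If $\alpha_N\gg\theta_3$, then $\lim_{N\to\infty}\mathbb P_{\xi^x}[\eta_N(\alpha_N)=\xi^y]=|S_\star|^{-1}$ for all $y\in S_\star$.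
   Context: $\mathbb N=\{0,1,2,\dots\}$, $\llbracket\alpha,\beta\rrbracket:=[\alpha,\beta]\cap\mathbb Z$, and $f\ll g$ (equivalently $g\gg f$) means $\lim_{N\to\infty}f(N)/g(N)=0$. $S$ is a finite set and $r:S\times S\to[0,\infty)$, $r(x,x)=0$, are the jump rates of an irreducible continuous-time Markov chain on $S$, reversible with respect to its stationary measure $(m_x)_{x\in S}$ (i.e. $m_xr(x,y)=m_yr(y,x)$), normalized by $\max_xm_x=1$. $\mathcal H_N:=\{\eta\in\mathbb N^S:\sum_x\eta_x=N\}$. The inclusion process $\{\eta_N(t)\}_{t\ge0}$ is the continuous-time Markov chain on $\mathcal H_N$ which jumps from $\eta$ to $\eta^{x,y}$ (one particle moved from $x$ to $y\neq x$) at rate $\eta_x(d_N+\eta_y)r(x,y)$. Here $d_N>0$ satisfies $\lim_Nd_N\log N=0$ and $\lim_Nd_Ne^{\epsilon N}=\infty$ for all $\epsilon>0$. $\mathbb P_\eta$ is the law of the process started at $\eta$. $S_\star:=\{x\in S:m_x=1\}$, $S_0:=S\setminus S_\star$; $\xi^x\in\mathcal H_N$ is the configuration with all $N$ particles at $x$. $S_\star=\bigcup_{i=1}^{\kappa_2}S_{\star i}^2$ is the decomposition of $S_\star$ into the connected components of the graph on $S_\star$ with edges $\{x,y\}$, $r(x,y)>0$. Join $i\ne j$ in $\llbracket1,\kappa_2\rrbracket$ if there are $x\in S_{\star i}^2$, $y\in S_{\star j}^2$, $a\in S_0$ with $r(x,a)>0$ and $r(y,a)>0$; the unions of the $S_{\star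 i}^2$ over the connected components of this graph on $\llbracket1,\kappa_2\rrbracket$ give the decomposition $S_\star=\bigcup_{i=1}^{\kappa_3}S_{\star i}^3$. *)

(* Defs.v *)
From HB Require Import structures.
From mathcomp Require Import all_boot all_order all_algebra.
From mathcomp Require Import all_classical all_reals all_analysis.

Set Implicit Arguments.
Unset Strict Implicit.
Unset Printing Implicit Defensive.

Import Order.TTheory GRing.Theory Num.Theory.
Import numFieldNormedType.Exports.

Local Open Scope classical_set_scope.
Local Open Scope ring_scope.

Definition asym_lt (R : realType) (f g : nat -> R) : Prop :=
  f N / g N @[N --> \oo] --> 0.

(* In this block [q x y] is the jump rate from [x] to [y]; the diagonal of [q]
   plays no role, since it cancels in [generator]. *)
Section MarkovChain.
Variables (R : realType) (T : finType).
Implicit Types (q : T -> T -> R) (x y : T) (t : R).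

Definition generator q (f : T -> R) : T -> R :=
  fun x => \sum_y q x y * (f y - f x).

(* The entry [(x, y)] of [exp (t L)], where [L = generator q]; the exponential
   series always converges because [T] is finite. *)
Definition transition q t x y : R :=
  limn (series (fun k =>
    exp_coeff t k * iter k (generator q) (fun z => (z == y)%:R) x)).

(* For [s = (t1, y1) :: ... :: (tn, yn)], the product of the transition
   probabilities of [x] at time [t0], [y1] at time [t1], ... , [yn] at time
   [tn]. *)
Fixpoint path_prob q (t0 : R) x (s : seq (R * T)) : R :=
  if s is (t, y) :: s' then transition q (t - t0) x y * path_prob q t y s'
  else 1.

(* [X t], [0 <= t], is a cadlag process which, under [P x], is the
   continuous-time Markov chain with jump rates [q] started at [x]. The values
   of [X] at negative times are irrelevant. *)
Record is_markov_chain q (disp : measure_display) (Om : measurableType disp)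
    (P : T -> probability Om R) (X : R -> Om -> T) : Prop := {
  mc_measurable : forall t y, 0 <= t -> measurable [set w | X t w = y];
  mc_right_continuous : forall w t, 0 <= t ->
    \forall s \near t^'+, X s w = X t w;
  mc_left_limit : forall w t, 0 < t ->
    exists y, \forall s \near t^'-, X s w = y;
  mc_start : forall x, P x [set w | X 0 w = x] = 1%E;
  mc_fdd : forall x (s : seq (R * T)), path <=%R 0 [seq u.1 | u <- s] ->
    P x [set w | forall u, u \in s -> X u.1 w = u.2] = (path_prob q 0 x s)%:E
}.

Definition irreducible q : Prop :=
  forall x y, connect [rel a b | 0 < q a b] x y.

Definition stationary q (m : T -> R) : Prop :=
  forall y, \sum_x m x * q x y = m y * \sum_x q y x.

Definition reversible q (m : T -> R) : Prop :=
  forall x y, m x * q x y = m y * q y x.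

End MarkovChain.

(* The connected components of the graph on [V] with edge relation [e]
   (assumed symmetric on [V]). *)
Definition components (T : finType) (V : {set T}) (e : rel T) : {set {set T}} :=
  equivalence_partition
    (connect [rel x y | [&& x \in V, y \in V & e x y]]) V.

Section Decompositions.
Variables (R : realType) (S : finType) (r : S -> S -> R) (m : S -> R).

Definition Sstar : {set S} := [set x | m x == 1]%SET.

Definition S0 : {set S} := ~: Sstar.

(* The set of all blocks [S_{star i}^2], so that [kappa_2 = #|comps2|]; the
   index [i] is replaced by the block itself. *)
Definition comps2 : {set {set S}} := components Sstar [rel x y | 0 < r x y].

Definition adj2 : rel {set S} := [rel A B : {set S} | (A != B) &&
  [exists x in A, exists y in B, exists a in S0, (0 < r x a) && (0 < r y a)]].

(* The set of all blocks [S_{star j}^3]. *)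
Definition comps3 : {set {set S}} :=
  [set finset.cover C | C in components comps2 adj2]%SET.

End Decompositions.

(* Occupation numbers of a configuration of [N] particles are at most [N], so
   they are taken in ['I_N.+1], which makes the state space a finite type. *)
Record config (S : finType) (N : nat) : Type := Config {
  config_val :> {ffun S -> 'I_N.+1};
  configP : (\sum_x (config_val x : nat))%N == N
}.

HB.instance Definition _ (S : finType) (N : nat) :=
  [isSub for @config_val S N].
HB.instance Definition _ (S : finType) (N : nat) :=
  [Finite of config S N by <:].

Section Inclusion.
Variables (R : realType) (S : finType) (r : S -> S -> R).

Definition occ N (eta : config S N) (x : S) : nat := eta x.

(* [eta^{x,y}]; only meaningful if [x != y] and [0 < occ eta x]. *)
Definition move N (eta : config S N) (x y z : S) : nat :=
  if z == x then (occ eta x).-1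
  else if z == y then (occ eta y).+1
  else occ eta z.

Definition inclusion_rate (dN : R) N (eta zeta : config S N) : R :=
  \sum_x \sum_(y | (y != x) && [forall z, occ zeta z == move eta x y z])
    (occ eta x)%:R * (dN + (occ eta y)%:R) * r x y.

Lemma xi_subproof N (x : S) :
  (\sum_z (([ffun z => if z == x then ord_max else ord0]
             : {ffun S -> 'I_N.+1}) z : nat))%N == N.
Proof.
rewrite (bigD1 x) //= ffunE eqxx big1 ?addn0 // => z zx.
by rewrite ffunE (negbTE zx).
Qed.

Definition xi N (x : S) : config S N := Config (xi_subproof N x).

End Inclusion.

(* Main.v *)
Require Import Defs.
From HB Require Import structures.
From mathcomp Require Import all_boot all_order all_algebra.
From mathcomp Require Import all_classical all_reals all_analysis.
From mathcomp Require Import ring lra zify.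

Import Order.TTheory GRing.Theory Num.Theory.
Import numFieldNormedType.Exports.

Local Open Scope classical_set_scope.
Local Open Scope ring_scope.

Set Implicit Arguments.
Unset Strict Implicit.
Unset Printing Implicit Defensive.

(** The law of the process at one time only involves the semigroup [P_t] of a
    chain that is reversible with respect to the product weight
    [W eta = \prod_z m z ^+ eta z * w (eta z)], [w n] being the coefficients of
    [(1 - z) ^ (- d)].  Everything is therefore read off from the energy
    (Dirichlet form) of the chain, through two consequences of
    [d/dt P_t f = L P_t f] and reversibility:
    - [|f - P_t f|^2 <= t * energy f] ([semigroup_dist]): a function of small
      energy that separates two groups of condensates prevents transitions
      between them;
    - [2 t * energy (P_t g) <= |g|^2] ([semigroup_energy]): if energies control
      [(h (xi x) - h (xi y)) ^ 2], then [P_t g] takes almost the same value at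
      [xi x] and [xi y] after a long time.

    Let [Theta_j = N ^ j / d ^ (j + 1)], so that [Theta_0], [Theta_1] and
    [Theta_2] are the three time scales.  The exponent [j] counts sites of [S0]
    in the bonds that have to be crossed.

    To move all particles from [x] to [y] one can send them one at a time
    along a path.  A particle crosses a bond [b - b'] of that path over a
    background of [n] particles at [x] and the others at [y]; the conductance of
    this jump loses a factor [d / N] for each of [x], [y] that is not an
    endpoint of the bond.  So the resistance, relative to the weight of a
    condensate, is of order at most [Theta_0] for a direct jump, [Theta_1]
    through a common neighbour, and [Theta_2] along any path ([edge_bound],
    [close_neighbour], [close_common_neighbour], [close_irreducible]).

    Conversely let [V] be a set of sites such that each bond between [V] and its
    complement has at least [j] endpoints in [S0].  The function [cutoff V] of
    the fraction of particles in [V] is flat near [0] and near [1], so only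
    configurations with a positive fraction on both sides contribute to its
    energy.  These have two macroscopic occupation numbers; they are in [Sstar]
    up to exponentially small weights, and an endpoint in [S0] of the crossed
    bond then carries few particles, which costs [d / N] per such endpoint
    ([bulk_pair], [energy_cutoff]).  The sets to use are [{x}] for [Theta_0], a
    block of [comps2] for [Theta_1], and a block of [comps3] together with its
    neighbours in [S0] for [Theta_2].

    Finally the weight of the non-condensed configurations is negligible
    because [\sum_(k <= N) w k = \prod_(k <= N) (1 + d / k)] tends to [1]
    ([rise_cvg], [not_condensed_weight]).  Hence, on each window of times, the
    matrix of transition probabilities between condensates is asymptotically
    stochastic on a block, its rows coincide on this block, and it is symmetric
    since all [xi x] with [x] in [Sstar] have the same weight: its entries tend
    to the inverse of the size of the block ([equidistributed]). *)

(** * Reversible Markov chains on a finite set *)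

Lemma le_of_eq (R : numDomainType) (a b : R) : a = b -> a <= b.
Proof. by move=> ->. Qed.

Lemma is_derive_sumr (R : realType) (I : Type) (s : seq I) (F : I -> R -> R)
    (D : I -> R) (t : R) :
  (forall i, is_derive t (1 : R) (F i) (D i)) ->
  is_derive t (1 : R) (fun x => \sum_(i <- s) F i x) (\sum_(i <- s) D i).
Proof.
move=> FD; elim: s => [|i s IHs].
  rewrite big_nil (_ : (fun _ => _) = cst 0); first exact: is_derive_cst.
  by apply/funext => x; rewrite big_nil.
rewrite big_cons (_ : (fun _ => _) = F i + (fun x => \sum_(i <- s) F i x)).
  exact: is_deriveD.
by apply/funext => x; rewrite big_cons.
Qed.

Lemma cvg_sumr (R : realType) (I : Type) (s : seq I) (F : I -> nat -> R)
    (l : I -> R) :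
  (forall i, F i n @[n --> \oo] --> l i) ->
  \sum_(i <- s) F i n @[n --> \oo] --> \sum_(i <- s) l i.
Proof. by move=> Fl; apply: cvg_big => [|i _]; [exact: add_continuous|]. Qed.

Lemma nonincreasing_from0 (R : realType) (F D : R -> R) (t : R) :
  (forall s, is_derive s (1 : R) F (D s)) -> (forall s, 0 < s -> D s <= 0) ->
  0 <= t -> F t <= F 0.
Proof.
move=> FD D0 t0; have dF s : derivable F s 1 by case: (FD s).
apply: (@ler0_derive1_nincry _ F 0) => //.
- move=> s; rewrite in_itv/= andbT => s0.
  by rewrite derive1E; case: (FD s) => _ ->; exact: D0.
- apply: continuous_subspaceT => s.
  by apply: differentiable_continuous; exact/derivable1_diffP.
Qed.

Section ReversibleChain.
Variables (R : realType) (T : finType) (q : T -> T -> R) (W : T -> R).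
Implicit Types (f g : T -> R) (t : R).

Definition inner f g : R := \sum_x W x * (f x * g x).

Definition energy f g : R :=
  2^-1 * \sum_x \sum_y W x * q x y * ((f y - f x) * (g y - g x)).

(** Values of [exp (t L) f]; [transition] is the case of an indicator. *)
Definition semigroup f t x : R :=
  limn (series (fun k => exp_coeff t k * iter k (generator q) f x)).

Lemma energyC f g : energy f g = energy g f.
Proof.
congr (_ * _); apply: eq_bigr => x _; apply: eq_bigr => y _.
by rewrite [(f y - _) * _]mulrC.
Qed.

Lemma innerC f g : inner f g = inner g f.
Proof. by apply: eq_bigr => x _; rewrite [f x * _]mulrC. Qed.

Lemma generator_sum (I : Type) (s : seq I) (c : I -> R) (F : I -> T -> R) x :
  generator q (fun z => \sum_(i <- s) c i * F i z) x =
  \sum_(i <- s) c i * generator q (F i) x.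
Proof.
rewrite /generator; under [RHS]eq_bigr do rewrite mulr_sumr.
rewrite exchange_big; apply: eq_bigr => y _ /=.
rewrite -sumrB mulr_sumr; apply: eq_bigr => i _.
by rewrite -mulrBr mulrCA.
Qed.

Lemma iter_generator_sum (I : Type) (s : seq I) (c : I -> R) (F : I -> T -> R)
    k x :
  iter k (generator q) (fun z => \sum_(i <- s) c i * F i z) x =
  \sum_(i <- s) c i * iter k (generator q) (F i) x.
Proof.
elim: k x => [//|k IHk] x; rewrite iterS -generator_sum.
by congr (generator _ _ _); apply/funext => z; rewrite IHk.
Qed.

(** The powers of the generator grow at most geometrically, so the exponential
    series converges for every time. *)
Lemma iter_generator_bound f :
  exists2 K, 0 <= K &
    forall k x, `|iter k (generator q) f x| <= (\sum_y `|f y|) * K ^+ k.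
Proof.
set K := \sum_x \sum_y `|q x y| * 2; exists K.
  by do 2![apply: sumr_ge0 => ? _]; rewrite mulr_ge0.
move=> k; elim: k => [|k IHk] x /=.
  by rewrite mulr1 (bigD1 x)//= lerDl sumr_ge0.
set B := \sum_y `|f y| in IHk *.
apply: (@le_trans _ _ ((\sum_y `|q x y| * 2) * (B * K ^+ k))).
  rewrite (le_trans (ler_norm_sum _ _ _))// mulr_suml; apply: ler_sum => y _.
  rewrite normrM -mulrA ler_wpM2l// (le_trans (ler_normB _ _))//.
  by rewrite mulr_natl mulr2n lerD.
rewrite exprS mulrCA ler_wpM2l ?sumr_ge0// ler_wpM2r//.
  by rewrite exprn_ge0// /K; do 2![apply: sumr_ge0 => ? _]; rewrite mulr_ge0.
rewrite /K [leRHS](bigD1 x)//= lerDl sumr_ge0// => z _.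
by apply: sumr_ge0 => y _; rewrite mulr_ge0.
Qed.

Lemma is_cvg_semigroup f t x :
  cvgn (series (fun k => exp_coeff t k * iter k (generator q) f x)).
Proof.
have [K K0 fK] := iter_generator_bound f; set B := \sum_y _ in fK.
apply: (@normed_cvg R R^o).
apply: (@series_le_cvg R _ (fun k => B * exp_coeff (`|t| * K) k)).
- by move=> k /=.
- by move=> k; rewrite mulr_ge0 ?sumr_ge0// exp_coeff_ge0 ?mulr_ge0.
- move=> k; rewrite /= normrM /exp_coeff/= normrM normfV normrX exprMn.
  rewrite [`|_%:R|]ger0_norm//.
  rewrite [leRHS](_ : _ = `|t| ^+ k / k`!%:R * (B * K ^+ k)); last by ring.
  by rewrite ler_wpM2l// divr_ge0// exprn_ge0.
- by apply: (@is_cvg_seriesZ _ _ B); exact: is_cvg_series_exp_coeff.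
Qed.

Lemma cvg_semigroup f t x :
  series (fun k => exp_coeff t k * iter k (generator q) f x) @ \oo -->
  semigroup f t x.
Proof. exact: is_cvg_semigroup. Qed.

Lemma semigroup_sum (I : Type) (s : seq I) (c : I -> R) (F : I -> T -> R) t x :
  semigroup (fun z => \sum_(i <- s) c i * F i z) t x =
  \sum_(i <- s) c i * semigroup (F i) t x.
Proof.
apply/cvg_lim => //.
rewrite (_ : series _ = fun n => \sum_(i <- s)
    c i * series (fun k => exp_coeff t k * iter k (generator q) (F i) x) n).
  apply: cvg_sumr => i; apply: cvgM; [exact: cvg_cst|exact: cvg_semigroup].
apply/funext => n; rewrite /series/=.
under [RHS]eq_bigr do rewrite mulr_sumr.
rewrite exchange_big/=; apply: eq_bigr => k _.
rewrite iter_generator_sum mulr_sumr; apply: eq_bigr => i _.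
by rewrite mulrCA.
Qed.

Lemma semigroup_transition f t x :
  semigroup f t x = \sum_y f y * transition q t x y.
Proof.
rewrite -(semigroup_sum (index_enum T) f (fun y z => (z == y)%:R)).
congr (semigroup _ t x); apply/funext => z; rewrite (bigD1 z)//= eqxx mulr1.
by rewrite big1 ?addr0// => i /negPf; rewrite eq_sym => ->; rewrite mulr0.
Qed.

Lemma semigroup0 f x : semigroup f 0 x = f x.
Proof.
apply/cvg_lim => //; rewrite -(cvg_shiftn 1).
rewrite (_ : (fun n => _) = cst (f x)); first exact: cvg_cst.
apply/funext => n; rewrite /series/= addn1 big_nat_recl//= /exp_coeff/=.
rewrite expr0 fact0 divr1 mul1r big1 ?addr0// => i _.
by rewrite expr0n/= !mul0r.
Qed.

(** Differentiating the exponential series termwise gives Kolmogorov's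
    backward equation. *)
Lemma is_derive_semigroup f t x :
  is_derive t (1 : R) (fun s => semigroup f s x)
    (generator q (semigroup f t) x).
Proof.
pose c g := fun k => (k`!%:R)^-1 * iter k (generator q) g x.
have cE g s : pseries (c g) s =
    series (fun k => exp_coeff s k * iter k (generator q) g x).
  apply/funext => n; apply: eq_bigr => k _; rewrite /c /exp_coeff/=; ring.
have cS g : pseries_diffs (c g) = c (generator q g).
  apply/funext => n; rewrite /pseries_diffs /c -iterSr factS natrM invfM.
  by rewrite -!mulrA mulVKf.
have cvc g s : cvgn (pseries (c g) s) by rewrite cE; exact: is_cvg_semigroup.
have -> : (fun s => semigroup f s x) = (fun s => limn (pseries (c f) s)).
  by apply/funext => s; rewrite cE.
have -> : generator q (semigroup f t) x = limn (pseries (pseries_diffs (c f)) t).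
  rewrite cS cE; symmetry; apply/cvg_lim => //.
  rewrite (_ : series _ = fun n => generator q
      (fun z => series (fun k => exp_coeff t k * iter k (generator q) f z) n) x).
    apply: cvg_sumr => y; apply: cvgM; first exact: cvg_cst.
    apply: cvgB; exact: cvg_semigroup.
  apply/funext => n; rewrite /series/= generator_sum; apply: eq_bigr => k _.
  by rewrite -iterSr.
apply: (@pseries_snd_diffs _ _ (`|t| + 1)); rewrite ?cS//.
by rewrite [ltRHS]ger0_norm ?addr_ge0// ltrDl.
Qed.

Hypothesis W_ge0 : forall x, 0 <= W x.
Hypothesis q_ge0 : forall x y, 0 <= q x y.
Hypothesis qW : reversible q W.

Lemma inner_ge0 f : 0 <= inner f f.
Proof. by apply: sumr_ge0 => x _; rewrite mulr_ge0// -expr2 sqr_ge0. Qed.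

Lemma energy_ge0 f : 0 <= energy f f.
Proof.
rewrite mulr_ge0// sumr_ge0// => x _; apply: sumr_ge0 => y _.
by apply: mulr_ge0; [exact: mulr_ge0|rewrite -expr2 sqr_ge0].
Qed.

(** Distinct sources make the jumps [e i -> e' i] distinct terms of the double
    sum in [energy]. *)
Lemma energy_family n (e e' : 'I_n -> T) f : injective e ->
  \sum_(i < n) W (e i) * q (e i) (e' i) * (f (e' i) - f (e i)) ^+ 2 <=
  2 * energy f f.
Proof.
move=> e_inj; rewrite mulrA divff ?mul1r ?pnatr_eq0//.
pose G x y := W x * q x y * ((f y - f x) * (f y - f x)).
have G0 x y : 0 <= G x y.
  by apply: mulr_ge0; [exact: mulr_ge0|rewrite -expr2 sqr_ge0].
apply: (@le_trans _ _ (\sum_(i < n) \sum_y G (e i) y)).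
  by apply: ler_sum => i _; rewrite (bigD1 (e' i))//= lerDl sumr_ge0.
rewrite -(big_imset (fun x => \sum_y G x y) (h := e) (A := predT)) /=; last first.
  by move=> ? ? _ _; exact: e_inj.
rewrite [leRHS](bigID (mem [set e i | i in predT]%SET))/= lerDl.
by apply: sumr_ge0 => x _; apply: sumr_ge0 => y _; exact: G0.
Qed.

(** Summation by parts; reversibility is what makes the jump from [x] to [y]
    and the one back contribute equally. *)
Lemma inner_generator f g : inner f (generator q g) = - energy f g.
Proof.
have E1 : inner f (generator q g) =
    \sum_x \sum_y W x * q x y * (f x * (g y - g x)).
  by apply: eq_bigr => x _; rewrite !mulr_sumr; apply: eq_bigr => y _; ring.
have E2 : inner f (generator q g) =
    \sum_x \sum_y W x * q x y * (f y * (g x - g y)).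
  rewrite E1 exchange_big; apply: eq_bigr => x _; apply: eq_bigr => y _ /=.
  by rewrite qW.
apply: (@mulfI _ 2%:R) => //; rewrite mulrN mulrA divff// mul1r.
rewrite mulr_natl mulr2n {1}E1 E2 -big_split/= -sumrN; apply: eq_bigr => x _.
rewrite -big_split/= -sumrN; apply: eq_bigr => y _; ring.
Qed.

Lemma inner_generatorC f g :
  inner (generator q f) g = inner f (generator q g).
Proof. by rewrite innerC !inner_generator energyC. Qed.

Lemma transition_sym t x y : W x * transition q t x y = W y * transition q t y x.
Proof.
have innerd f z : inner (fun w => (w == z)%:R) f = W z * f z.
  rewrite /inner (bigD1 z)//= eqxx mul1r big1 ?addr0// => w /negPf->.
  by rewrite mul0r mulr0.
have sym k : W x * iter k (generator q) (fun w => (w == y)%:R) x =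
             W y * iter k (generator q) (fun w => (w == x)%:R) y.
  rewrite -!innerd [RHS]innerC.
  elim: k (fun w => _) (fun w => _) => [//|k IHk] f g.
  by rewrite iterSr IHk iterS inner_generatorC.
have lim z w : W z * transition q t z w =
    limn (fun n => W z * series (fun k => exp_coeff t k *
      iter k (generator q) (fun v => (v == w)%:R) z) n).
  symmetry; apply/cvg_lim => //.
  by apply: cvgM; [exact: cvg_cst|exact: cvg_semigroup].
rewrite !lim; congr (limn _); apply/funext => n; rewrite /series/= !mulr_sumr.
by apply: eq_bigr => k _; rewrite mulrCA sym mulrCA.
Qed.

Lemma is_derive_prod (f g : R -> R) (df dg t : R) :
  is_derive t (1 : R) f df -> is_derive t (1 : R) g dg ->
  is_derive t (1 : R) (fun s => f s * g s) (df * g t + f t * dg).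
Proof.
move=> Df Dg; rewrite addrC [df * _]mulrC; exact: is_deriveM.
Qed.

Lemma is_derive_inner (u : R -> T -> R) (u' : T -> R) t :
  (forall x, is_derive t (1 : R) (u^~ x) (u' x)) ->
  is_derive t (1 : R) (fun s => inner (u s) (u s)) (2 * inner (u t) u').
Proof.
move=> du; rewrite mulr_sumr; apply: is_derive_sumr => x.
apply: is_derive_eq; rewrite /GRing.scale/=; ring.
Qed.

Lemma is_derive_energy (u : R -> T -> R) (u' : T -> R) t :
  (forall x, is_derive t (1 : R) (u^~ x) (u' x)) ->
  is_derive t (1 : R) (fun s => energy (u s) (u s)) (2 * energy (u t) u').
Proof.
move=> du.
have dterm x y : is_derive t (1 : R)
    (fun s => W x * q x y * ((u s y - u s x) * (u s y - u s x)))
    (W x * q x y * (2 * ((u t y - u t x) * (u' y - u' x)))).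
  by apply: is_derive_eq; rewrite /GRing.scale/=; ring.
have dsum := is_derive_sumr (index_enum T)
  (fun x => is_derive_sumr (index_enum T) (dterm x)).
apply: (is_derive_eq (is_derive_prod (is_derive_cst (2^-1 : R) t 1) dsum)).
rewrite mul0r add0r /energy [RHS]mulrCA; congr (_ * _).
rewrite mulr_sumr; apply: eq_bigr => x _; rewrite mulr_sumr.
by apply: eq_bigr => y _; rewrite mulrCA.
Qed.

(** How far the semigroup moves a function of small energy: the derivative in
    [t] of the left side minus the right side is
    [- energy (f - P_t f) - energy (P_t f)]. *)
Lemma semigroup_dist f t : 0 <= t ->
  inner (fun x => f x - semigroup f t x) (fun x => f x - semigroup f t x) <=
  t * energy f f.
Proof.
move=> t0; rewrite -subr_le0.
pose u s := fun x => f x - semigroup f s x.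
pose D s := 2 * inner (u s) (fun x => - generator q (semigroup f s) x) -
            energy f f.
have FD s : is_derive s (1 : R) (fun s => inner (u s) (u s) - s * energy f f) (D s).
  have du x := is_derive_semigroup f s x.
  have dI : is_derive s (1 : R) (fun s => inner (u s) (u s))
      (2 * inner (u s) (fun x => - generator q (semigroup f s) x)).
    apply: is_derive_inner => x.
    apply: (is_derive_eq (is_deriveB (is_derive_cst (f x) s (1 : R)) (du x))).
    by rewrite sub0r.
  apply: (is_deriveB dI); apply: is_derive_eq.
  by rewrite /GRing.scale/= mulr0 add0r mulr1.
apply: le_trans (nonincreasing_from0 FD _ t0) _ => [s _|].
  have innerBl g h k : inner (fun x => g x - h x) (fun x => - k x) =
      inner h k - inner g k.
    rewrite /inner -sumrB; apply: eq_bigr => x _; ring.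
  rewrite /D innerBl !inner_generator.
  have -> : 2 * (- energy (semigroup f s) (semigroup f s) -
       - energy f (semigroup f s)) - energy f f =
     - energy (semigroup f s) (semigroup f s) - energy (u s) (u s).
    have -> : energy (u s) (u s) = energy f f - 2 * energy f (semigroup f s) +
        energy (semigroup f s) (semigroup f s).
      rewrite /energy [2 * _]mulrCA -mulrBr -mulrDr; congr (_ * _).
      rewrite mulr_sumr -sumrN -!big_split/=; apply: eq_bigr => x _.
      rewrite mulr_sumr -sumrN -!big_split/=; apply: eq_bigr => y _.
      rewrite /u; ring.
    ring.
  by rewrite subr_le0 (le_trans _ (energy_ge0 _))// oppr_le0 energy_ge0.
rewrite mul0r subr0; apply: le_of_eq.
by rewrite /inner big1// => x _; rewrite /u semigroup0 subrr mul0r mulr0.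
Qed.

(** Dissipation of energy: the derivative in [t] of
    [|P_t f|^2 + 2 t energy (P_t f)] is [- 4 t |L P_t f|^2]. *)
Lemma semigroup_energy f t : 0 <= t ->
  2 * t * energy (semigroup f t) (semigroup f t) <= inner f f.
Proof.
move=> t0; pose u s := semigroup f s.
pose D s := 2 * inner (u s) (generator q (u s)) +
  (2 * energy (u s) (u s) + 2 * s * (2 * energy (u s) (generator q (u s)))).
have FD s : is_derive s (1 : R)
    (fun s => inner (u s) (u s) + 2 * s * energy (u s) (u s)) (D s).
  have du x := is_derive_semigroup f s x.
  have dE := is_derive_energy du.
  apply: (is_deriveD (is_derive_inner du)); apply: is_derive_eq.
  by rewrite /GRing.scale/=; ring.
apply: (@le_trans _ _ (inner (u t) (u t) + 2 * t * energy (u t) (u t))).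
  by rewrite lerDr inner_ge0.
apply: le_trans (nonincreasing_from0 FD _ t0) _ => [s s0|].
  rewrite /D energyC -(opprK (energy (generator q _) _)) -inner_generator.
  rewrite inner_generator.
  have : 0 <= s * inner (generator q (u s)) (generator q (u s)).
    by rewrite mulr_ge0 ?inner_ge0// ltW.
  nra.
rewrite mulr0 mul0r addr0; apply: le_of_eq.
by apply: eq_bigr => x _; rewrite /u semigroup0.
Qed.

End ReversibleChain.

(** * Weights of occupation numbers *)

Section Weights.
Variables (R : realType) (d : R).
Hypothesis d_ge0 : 0 <= d.
Implicit Types n N : nat.

(** [rise n] is at once the partial sum of the first [n + 1] weights and, up to
    the factor [d], the value of [n.+1%:R * weight n.+1]; every estimate on
    weights below is a comparison with it. *)
Definition rise n : R := \prod_(k < n) (1 + d / k.+1%:R).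

(** The coefficients of [(1 - z)^(- d)], that is
    [Gamma(n + d) / (n! Gamma(d))]. *)
Definition weight n : R := if n is k.+1 then d / n%:R * rise k else 1.

Lemma riseS n : rise n.+1 = rise n * (1 + d / n.+1%:R).
Proof. by rewrite /rise big_ord_recr. Qed.

Lemma rise_ge1 n : 1 <= rise n.
Proof.
elim: n => [|n IHn]; first by rewrite /rise big_ord0.
by rewrite riseS mulr_ege1// lerDl divr_ge0.
Qed.

Lemma rise_gt0 n : 0 < rise n.
Proof. exact: lt_le_trans (rise_ge1 n). Qed.

Lemma rise_homo n N : (n <= N)%N -> rise n <= rise N.
Proof.
move=> /subnKC <-; elim: (N - n)%N => [|k IHk]; first by rewrite addn0.
rewrite addnS riseS (le_trans IHk)// ler_peMr ?(ltW (rise_gt0 _))//.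
by rewrite lerDl divr_ge0.
Qed.

Lemma weight_ge0 n : 0 <= weight n.
Proof.
by case: n => [//|n]; rewrite /weight mulr_ge0 ?divr_ge0// ltW ?rise_gt0.
Qed.

Lemma weightS n : n.+1%:R * weight n.+1 = d * rise n.
Proof. by rewrite /weight mulrA mulrCA divff ?mulr1// pnatr_eq0. Qed.

Lemma weight_shift n : (d + n%:R) * weight n = d * rise n.
Proof.
case: n => [|n]; first by rewrite /rise big_ord0 addr0.
rewrite riseS /weight; field.
by rewrite ?natr1 ?nat1r pnatr_eq0.
Qed.

Lemma weight_recr n : n.+1%:R * weight n.+1 = (d + n%:R) * weight n.
Proof. by rewrite weightS weight_shift. Qed.

Lemma sum_weight n : \sum_(k < n.+1) weight k = rise n.
Proof.
elim: n => [|n IHn]; first by rewrite big_ord1 /rise big_ord0.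
by rewrite big_ord_recr/= IHn riseS mulrDr mulr1 mulrC.
Qed.

Lemma sum_weight_gt0 n : \sum_(k < n.+1) (0 < k)%:R * weight k = rise n - 1.
Proof.
rewrite -sum_weight !big_ord_recl/= mul0r add0r addrAC subrr add0r.
by apply: eq_bigr => i _; rewrite mul1r.
Qed.

Lemma natr_weight_le n N : (n <= N)%N -> n%:R * weight n <= d * rise N.
Proof.
case: n => [|n] nN; first by rewrite mul0r mulr_ge0// ltW ?rise_gt0.
by rewrite weightS ler_wpM2l// rise_homo// ltnW.
Qed.

Lemma shift_weight_le n N :
  (n <= N)%N -> (d + n%:R) * weight n <= d * rise N.
Proof. by move=> nN; rewrite weight_shift ler_wpM2l// rise_homo. Qed.

Lemma shift_weight_ge n : d <= (d + n%:R) * weight n.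
Proof. by rewrite weight_shift ler_peMr// rise_ge1. Qed.

Hypothesis d_le1 : d <= 1.

Lemma weight_le1 n : weight n <= 1.
Proof.
elim: n => [//|n IHn]; have n0 : 0 < n.+1%:R :> R by [].
rewrite -(ler_pM2l n0) mulr1 weight_recr (le_trans (ler_piMr _ IHn)) ?addr_ge0//.
by rewrite -natr1 addrC lerD2l.
Qed.

Lemma weight_ge n N : (n <= N)%N -> (0 < N)%N -> d / N%:R <= weight n.
Proof.
move=> nN N0; have N0' : 0 < N%:R :> R by rewrite ltr0n.
case: n => [|n] in nN *.
  by rewrite /weight ler_pdivrMr// mul1r (le_trans d_le1)// ler1n.
rewrite /weight (@le_trans _ _ (d / n.+1%:R))//.
  by rewrite ler_wpM2l// lef_pV2 ?posrE// ler_nat.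
by rewrite ler_peMr ?divr_ge0 ?rise_ge1.
Qed.

End Weights.

Lemma harmonic_le_ln (R : realType) (n : nat) :
  \sum_(k < n.+1) (k.+1%:R)^-1 <= 1 + ln n.+1%:R :> R.
Proof.
elim: n => [|n IHn]; first by rewrite big_ord1 ln1 invr1 addr0.
rewrite big_ord_recr/= (le_trans (lerD IHn (lexx _)))// -addrA lerD2l.
have n1 : 0 < n.+1%:R :> R by []. have n2 : 0 < n.+2%:R :> R by [].
have := @le_ln1Dx R (- n.+2%:R^-1).
rewrite ltrN2 invf_lt1// ltr1n => /(_ isT).
have -> : 1 - n.+2%:R^-1 = n.+1%:R / n.+2%:R :> R.
  by rewrite -[n.+2%:R]natr1; field; rewrite nat1r natr1 pnatr_eq0.
rewrite ln_div ?posrE//; move: (ln _) (ln _) (_^-1) => a b c h. lra.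
Qed.

(** By comparison of the harmonic sum with the logarithm,
    [1 <= rise <= exp (d (1 + log N))]. *)
Lemma rise_cvg (R : realType) (d : nat -> R) :
  (forall N, (0 < N)%N -> 0 < d N) ->
  d N * ln N%:R @[N --> \oo] --> 0 -> d N @[N --> \oo] --> 0 ->
  rise (d N) N @[N --> \oo] --> (1 : R).
Proof.
move=> d_gt0 dln d0.
have cvE : expR (d N + d N * ln N%:R) @[N --> \oo] --> (1 : R).
  rewrite -[X in _ --> X]expR0.
  apply: continuous_cvg; first exact: continuous_expR.
  by rewrite -[X in _ --> X](addr0 0); exact: cvgD.
apply: (squeeze_cvgr _ (cvg_cst _) cvE).
exists 1%N => // -[//|N] _; have dN := d_gt0 N.+1 isT.
rewrite rise_ge1 ?(ltW dN)//= -[X in X + _]mulr1 -mulrDr.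
apply: (@le_trans _ _ (expR (d N.+1 * \sum_(k < N.+1) (k.+1%:R)^-1))).
  rewrite mulr_sumr expR_sum; apply: ler_prod => k _.
  by rewrite expR_ge1Dx andbT addr_ge0// divr_ge0// ltW.
by rewrite ler_expR ler_pM2l// harmonic_le_ln.
Qed.

(** The number of particles at [z1] is determined by all the other occupation
    numbers, so summing over them costs no factor for [z1]. *)
Lemma sum_config_le (R : realType) (S : finType) (N : nat) (Phi : S -> nat -> R)
    (z1 : S) (M : R) :
  (forall z n, 0 <= Phi z n) -> (forall n, (n <= N)%N -> Phi z1 n <= M) ->
  \sum_(eta : config S N) \prod_z Phi z (occ eta z) <=
  M * \prod_(z | z != z1) \sum_(n < N.+1) Phi z n.
Proof.
move=> Phi0 PhiM.
pose rho (eta : config S N) : {ffun S -> 'I_N.+1} :=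
  [ffun z => if z == z1 then ord0 else config_val eta z].
pose Psi z (i : 'I_N.+1) : R := if z == z1 then (i == ord0)%:R else Phi z i.
have rho_inj : injective rho.
  move=> eta zeta /ffunP eq_rho.
  have off z : z != z1 -> config_val eta z = config_val zeta z.
    by move=> zz1; have := eq_rho z; rewrite !ffunE (negPf zz1).
  apply/val_inj/ffunP => z /=; have [->|] := eqVneq z z1; last exact: off.
  apply/val_inj => /=.
  have : (\sum_z (config_val eta z : nat) =
          \sum_z (config_val zeta z : nat))%N.
    by rewrite (eqP (configP eta)) (eqP (configP zeta)).
  rewrite (bigD1 z1)//= [in RHS](bigD1 z1)//=.
  have -> : (\sum_(i | i != z1) (config_val eta i : nat) =
            \sum_(i | i != z1) (config_val zeta i : nat))%N.
    by apply: eq_bigr => i /off ->.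
  by move/addIn.
have M0 : 0 <= M by exact: le_trans (Phi0 z1 0%N) (PhiM 0%N isT).
have Psi0 z i : 0 <= Psi z i by rewrite /Psi; case: ifP.
apply: (@le_trans _ _ (M * \sum_(eta : config S N) \prod_z Psi z (rho eta z))).
  rewrite mulr_sumr; apply: ler_sum => eta _.
  rewrite (bigD1 z1)//= [in leRHS](bigD1 z1)//= /Psi ffunE eqxx eqxx mul1r.
  have -> : \prod_(i | i != z1) (if i == z1 then (rho eta i == ord0)%:R
      else Phi i (rho eta i)) = \prod_(i | i != z1) Phi i (occ eta i).
    by apply: eq_bigr => i /negPf iz1; rewrite iz1 ffunE iz1.
  apply: ler_wpM2r; first exact: prodr_ge0.
  by apply: PhiM; rewrite -ltnS; exact: ltn_ord.
rewrite ler_wpM2l//.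
have -> : \prod_(z | z != z1) \sum_(n < N.+1) Phi z n =
    \prod_z \sum_(i < N.+1) Psi z i.
  rewrite [RHS](bigD1 z1)//= {1}/Psi eqxx.
  have -> : \sum_(i < N.+1) ((i == ord0)%:R : R) = 1.
    by rewrite (bigD1 ord0)//= big1 ?addr0// => i /negPf->.
  rewrite mul1r; apply: eq_bigr => z /negPf zz1; apply: eq_bigr => i _.
  by rewrite /Psi zz1.
rewrite bigA_distr_bigA/=.
rewrite -(big_imset (fun g : {ffun S -> 'I_N.+1} => \prod_z Psi z (g z)) (h := rho)
  (A := predT)) /=; last by move=> ? ? _ _; exact: rho_inj.
rewrite [leRHS](bigID (mem [set rho eta | eta in predT]%SET))/= lerDl.
by apply: sumr_ge0 => g _; exact: prodr_ge0.
Qed.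

(** * The inclusion process and its stationary weight *)

Section Configurations.
Variables (S : finType) (N : nat).
Implicit Types (eta zeta : config S N) (g : S -> nat) (x y z b : S).

Lemma occ_inj eta zeta : (forall z, occ eta z = occ zeta z) -> eta = zeta.
Proof. by move=> eq_occ; apply/val_inj/ffunP => z; apply/val_inj/eq_occ. Qed.

Lemma occ_le eta z : (occ eta z <= N)%N.
Proof. by rewrite -ltnS; exact: ltn_ord. Qed.

Lemma sum_occ eta : (\sum_z occ eta z = N)%N.
Proof. exact/eqP/(configP eta). Qed.

Lemma occ_xi x z : occ (xi N x) z = ((z == x) * N)%N.
Proof.
by rewrite /occ /= ffunE; case: eqP => _; rewrite ?mul1n ?mul0n.
Qed.

(** The default value makes this a total function of [g]; it is never used at
    a [g] whose values do not add up to [N]. *)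
Definition config_of (x0 : S) g : config S N :=
  insubd (xi N x0) [ffun z : S => inord (g z)].

Lemma occ_config_of x0 g z :
  (\sum_z g z = N)%N -> occ (config_of x0 g) z = g z.
Proof.
move=> sg; have gN t : (g t <= N)%N by rewrite -sg (bigD1 t)//= leq_addr.
have := val_insubd (xi N x0) [ffun t => inord (g t)].
rewrite -/(config_of x0 g) /occ /= => ->.
case: ifPn => [_|/negP[]]; first by rewrite ffunE inordK// ltnS.
by apply/eqP; rewrite -[RHS]sg; apply: eq_bigr => t _; rewrite ffunE inordK// ltnS.
Qed.

(** [zeta = eta^{x,y}] in a form that is symmetric under time reversal. *)
Definition moved eta zeta x y : bool :=
  (y != x) && [forall z, occ zeta z + (z == x) == occ eta z + (z == y)]%N.

Lemma movedP eta zeta x y : y != x ->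
  reflect (forall z, occ zeta z + (z == x) = occ eta z + (z == y))%N
          (moved eta zeta x y).
Proof.
move=> yx; rewrite /moved yx /=.
by apply: (iffP forallP) => h z; apply/eqP/h.
Qed.

Lemma moved_sym eta zeta x y : moved eta zeta x y = moved zeta eta y x.
Proof.
rewrite /moved eq_sym; congr (_ && _); apply: eq_forallb => z.
by rewrite eq_sym.
Qed.

Lemma moved_inj eta zeta1 zeta2 x y :
  moved eta zeta1 x y -> moved eta zeta2 x y -> zeta1 = zeta2.
Proof.
move=> /andP[yx /forallP h1] /andP[_ /forallP h2]; apply: occ_inj => z.
by apply: (@addIn (z == x)); rewrite (eqP (h1 z)) (eqP (h2 z)).
Qed.

End Configurations.

Section InclusionProcess.
Variables (R : realType) (S : finType) (r : S -> S -> R) (m : S -> R).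
Variables (d : R) (N : nat).
Implicit Types (eta zeta : config S N) (g : S -> nat) (x y z b : S).

Definition site_weight z n : R := m z ^+ n * weight d n.

(** The unnormalized stationary measure. *)
Definition config_weight g : R := \prod_z site_weight z (g z).

Lemma inclusion_rate_moved eta zeta : inclusion_rate r d eta zeta =
  \sum_x \sum_y (moved eta zeta x y)%:R *
    ((occ eta x)%:R * (d + (occ eta y)%:R) * r x y).
Proof.
apply: eq_bigr => x _; rewrite big_mkcond; apply: eq_bigr => y _ /=.
have [->|x0] := eqVneq (occ eta x) 0%N; first by rewrite !mul0r mulr0; case: ifP.
case: eqVneq => [->|yx] /=; first by rewrite /moved eqxx mul0r.
have -> : moved eta zeta x y = [forall z, occ zeta z == move eta x y z].
  rewrite /moved yx /=; apply: eq_forallb => z; rewrite /move.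
  have [->|zx] := eqVneq z x; last first.
    by have [->|zy] := eqVneq z y; apply/eqP/eqP; lia.
  by rewrite [x == y]eq_sym (negPf yx); apply/eqP/eqP; lia.
by case: ifP; rewrite ?mul1r ?mul0r.
Qed.

(** A jump from [b] to [b'] and its reverse are both the jump of one particle
    over a background [g] of the other particles, and the rate at which it
    occurs in equilibrium is an expression in [g] that is symmetric in [b] and
    [b']. *)
Lemma conductance eta g b b' : b' != b ->
  (forall z, occ eta z = g z + (z == b))%N ->
  config_weight (occ eta) * ((occ eta b)%:R * (d + (occ eta b')%:R) * r b b') =
  m b * r b b' * ((d + (g b)%:R) * (d + (g b')%:R) * config_weight g).
Proof.
move=> bb' etaE; rewrite !etaE eqxx (negPf bb') addn0 addn1.
rewrite /config_weight (bigD1 b)//= [in RHS](bigD1 b)//= etaE eqxx addn1.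
have -> : \prod_(i | i != b) site_weight i (occ eta i) =
          \prod_(i | i != b) site_weight i (g i).
  by apply: eq_bigr => i /negPf ib; rewrite etaE ib addn0.
set p := \prod_(i | _) _.
rewrite [LHS](_ : _ = (m b ^+ (g b).+1 * ((g b).+1%:R * weight d (g b).+1)) *
   (p * (d + (g b')%:R) * r b b')); last by rewrite /site_weight; ring.
rewrite weight_recr// exprS /site_weight; ring.
Qed.

Lemma inclusion_reversible : reversible r m ->
  reversible (inclusion_rate r d (N := N)) (fun eta => config_weight (occ eta)).
Proof.
move=> m_rev eta zeta; rewrite !inclusion_rate_moved.
rewrite [in RHS]exchange_big/= !mulr_sumr; apply: eq_bigr => x _.
rewrite !mulr_sumr; apply: eq_bigr => y _; rewrite [in RHS]moved_sym.
have [mv|] := boolP (moved eta zeta x y); last by rewrite !mul0r !mulr0.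
rewrite !mul1r; have yx : y != x by case/andP: mv.
have /movedP := mv; move=> /(_ yx) mvE.
pose g z := (occ zeta z - (z == y))%N.
have etaE z : occ eta z = (g z + (z == x))%N.
  have := mvE z; rewrite /g; have [->|] := eqVneq z y; last by lia.
  by rewrite (negPf yx); lia.
have zetaE z : occ zeta z = (g z + (z == y))%N.
  have := mvE z; rewrite /g; have [->|] := eqVneq z y; last by lia.
  by rewrite (negPf yx); lia.
rewrite (conductance yx etaE) (conductance _ zetaE) 1?eq_sym// m_rev.
by rewrite [(d + _) * (d + _)]mulrC.
Qed.

Hypothesis r_ge0 : forall x y, 0 <= r x y.
Hypothesis m_ge0 : forall x, 0 <= m x.
Hypothesis d_ge0 : 0 <= d.

Lemma site_weight_ge0 z n : 0 <= site_weight z n.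
Proof. by rewrite mulr_ge0 ?exprn_ge0 ?weight_ge0. Qed.

Lemma config_weight_ge0 g : 0 <= config_weight g.
Proof. by apply: prodr_ge0 => z _; exact: site_weight_ge0. Qed.

Lemma inclusion_rate_ge0 eta zeta : 0 <= inclusion_rate r d eta zeta.
Proof.
do 2![apply: sumr_ge0 => ? _]; rewrite mulr_ge0// mulr_ge0//.
by rewrite addr_ge0.
Qed.

End InclusionProcess.

(** * Lower bounds for the energy: resistance between condensates *)

Lemma sqr_sum_le (R : realType) n (D : 'I_n -> R) :
  (\sum_i D i) ^+ 2 <= n%:R * \sum_i D i ^+ 2.
Proof.
have E : \sum_i \sum_j (D i - D j) ^+ 2 =
    2 * (n%:R * (\sum_i D i ^+ 2) - (\sum_i D i) ^+ 2).
  transitivity (\sum_i \sum_j (D i ^+ 2 + D j ^+ 2 - 2 * (D i * D j))).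
    by apply: eq_bigr => i _; apply: eq_bigr => j _; ring.
  under eq_bigr do
    rewrite sumrB big_split/= sumr_const card_ord -mulr_sumr -mulr_sumr.
  rewrite sumrB big_split/= sumr_const card_ord -mulr_sumr -mulr_suml.
  under eq_bigr do rewrite -mulr_natl.
  rewrite -mulr_sumr -mulr_natl; ring.
rewrite -subr_ge0 -(pmulr_rge0 _ (ltr0n R 2)) -E.
by apply: sumr_ge0 => i _; apply: sumr_ge0 => j _; exact: sqr_ge0.
Qed.

Section Line.
Variables (R : realType) (S : finType) (N : nat) (x y : S).
Implicit Types (eta zeta : config S N.+1) (b z : S).

(** [n] particles at [x] and all the others but one at [y]; the last particle
    is the one that travels. *)
Definition background (n : nat) z : nat := ((z == x) * n + (z == y) * (N - n))%N.

Definition lineconf b n : config S N.+1 :=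
  config_of N.+1 x (fun z => background n z + (z == b))%N.

Lemma sum_delta b k : (\sum_z (z == b) * k = k)%N.
Proof.
rewrite (bigD1 b)//= eqxx mul1n big1 ?addn0// => z /negPf->.
by rewrite mul0n.
Qed.

Lemma occ_lineconf b n z : (n <= N)%N ->
  occ (lineconf b n) z = (background n z + (z == b))%N.
Proof.
move=> nN; rewrite occ_config_of// !big_split/= !sum_delta.
have := sum_delta b 1; under eq_bigr do rewrite muln1.
by move=> ->; rewrite subnKC// addn1.
Qed.

Hypothesis xy : x != y.

(** Moving the travelling particle from [x] to [y] at the background [n] ends
    where the move at the background [n - 1] starts, so the sum telescopes. *)
Lemma lineconf_ends (h : config S N.+1 -> R) :
  \sum_(n < N.+1) (h (lineconf x n)) - \sum_(n < N.+1) (h (lineconf y n)) =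
  h (xi N.+1 x) - h (xi N.+1 y).
Proof.
pose K n : config S N.+1 :=
  config_of N.+1 x (fun z => (z == x) * n + (z == y) * (N.+1 - n))%N.
have occK n z : (n <= N.+1)%N ->
    occ (K n) z = ((z == x) * n + (z == y) * (N.+1 - n))%N.
  by move=> nN; rewrite occ_config_of// big_split/= !sum_delta subnKC.
have -> : xi N.+1 x = K N.+1.
  by apply: occ_inj => z; rewrite occ_xi occK// subnn muln0 addn0.
have -> : xi N.+1 y = K 0%N.
  by apply: occ_inj => z; rewrite occ_xi occK// muln0 add0n subn0.
rewrite -sumrB -(telescope_sumr (fun n => h (K n)))// big_mkord.
apply: eq_bigr => n _; have nN : (n <= N)%N by rewrite -ltnS.
congr (h _ - h _); apply: occ_inj => z; rewrite occ_lineconf// /background.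
  by rewrite occK// subSS mulnS; lia.
by rewrite occK ?leqW// subSn// mulnS; lia.
Qed.

End Line.

Section Edge.
Variables (R : realType) (S : finType) (r : S -> S -> R) (m : S -> R).
Hypothesis r_ge0 : forall x y, 0 <= r x y.
Hypothesis m_ge0 : forall x, 0 <= m x.
Hypothesis m_rev : reversible r m.
Variables (d : R) (N : nat).
Hypothesis d_gt0 : 0 < d.
Hypothesis d_le1 : d <= 1.
Implicit Types (eta zeta : config S N.+1) (g : S -> nat) (b z : S).
Variables (x y : S).
Hypothesis mx : m x = 1.
Hypothesis my : m y = 1.
Hypothesis xy : x != y.

Let d_ge0 := ltW d_gt0.
Notation wt := (fun eta : config S N.+1 => config_weight m d (occ eta)).
Notation rate := (inclusion_rate r d (N := N.+1)).

Local Notation background := (background N x y).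
Local Notation lineconf := (lineconf N x y).

(** A site contributes a factor [d] if it is an endpoint of the bond, and a
    factor [d / N] if it is [x] or [y] but not an endpoint. *)
Lemma background_weight b b' n : (n <= N)%N -> b' != b ->
  d ^+ 2 * (d / N.+1%:R) ^+ #|([set x; y] :\: [set b; b'])%SET| <=
  (d + (background n b)%:R) * (d + (background n b')%:R) *
  config_weight m d (background n).
Proof.
move=> nN bb'.
have kN z : (background n z <= N)%N.
  rewrite /background; case: eqVneq => [->|_]; last by case: eqP; lia.
  by rewrite (negPf xy); lia.
pose e z : R := if z \in [set b; b']%SET then d + (background n z)%:R else 1.
have -> : (d + (background n b)%:R) * (d + (background n b')%:R) = \prod_z e z.
  rewrite (bigD1 b)//= (bigD1 b')//= /e !inE !eqxx orbT big1 ?mulr1 ?orTb//.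
  by move=> z /andP[/negPf zb /negPf zb']; rewrite !inE zb zb'.
have -> : d ^+ 2 * (d / N.+1%:R) ^+ #|([set x; y] :\: [set b; b'])%SET| =
    \prod_z (if z \in [set b; b']%SET then d
             else if z \in [set x; y]%SET then d / N.+1%:R else 1).
  rewrite (bigID (mem [set b; b']%SET))/=; congr (_ * _).
    rewrite (eq_bigr (fun=> d)) => [|z ->//].
    by rewrite prodr_const cards2 eq_sym bb'.
  rewrite -prodr_const big_mkcond [RHS]big_mkcond/=; apply: eq_bigr => z _.
  by rewrite finset.in_setD; case: (z \in _).
rewrite -big_split/=; apply: ler_prod => z _; apply/andP; split.
  by case: ifP => // _; case: ifP => // _; rewrite divr_ge0.
have zle := weight_ge d_ge0 d_le1 (leqW (kN z)) (ltn0Sn N).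
rewrite /e /site_weight; case: ifP => [_|_].
  case: (boolP (z \in [set x; y]%SET)) => [|].
    rewrite !inE => /orP[] /eqP->; rewrite ?mx ?my expr1n mul1r;
    exact: shift_weight_ge.
  rewrite !inE => /norP[/negPf zx /negPf zy].
  by rewrite /background zx zy !mul0n addn0 expr0 mul1r mulr1 addr0.
rewrite mul1r; case: (boolP (z \in [set x; y]%SET)) => [|].
  rewrite !inE => xyz; have -> : m z = 1 by case/orP: xyz => /eqP ->.
  by rewrite expr1n mul1r.
rewrite !inE => /norP[/negPf zx /negPf zy].
by rewrite /background zx zy !mul0n addn0 expr0 mul1r.
Qed.

(** Cauchy-Schwarz over the [N + 1] backgrounds, whose jumps over the given bond
    are distinct terms of the energy. *)
Lemma edge_bound b b' (h : config S N.+1 -> R) : 0 < m b * r b b' -> b' != b ->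
  (\sum_(n < N.+1) (h (lineconf b n)) - \sum_(n < N.+1) (h (lineconf b' n))) ^+ 2
  <= 2 / (m b * r b b') *
     (N.+1%:R /
       (d ^+ 2 * (d / N.+1%:R) ^+ #|([set x; y] :\: [set b; b'])%SET|)) *
     energy rate wt h h.
Proof.
move=> c0 bb'; set k := #|_|; set D := d ^+ 2 * _.
have D0 : 0 < D by rewrite mulr_gt0 ?exprn_gt0 ?divr_gt0.
have inj : injective (fun n : 'I_N.+1 => lineconf b n).
  move=> n1 n2 /(congr1 (fun eta => occ eta x)).
  rewrite !occ_lineconf; [|by rewrite -ltnS..]; rewrite /background eqxx (negPf xy).
  by move=> ?; apply/val_inj => /=; lia.
have := energy_family (q := rate) (W := wt) _ _ (fun n => lineconf b' n) h inj.
move=> /(_ (fun eta => config_weight_ge0 m_ge0 d_ge0 _)).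
move=> /(_ (inclusion_rate_ge0 r_ge0 d_ge0)) E2.
rewrite -sumrB (le_trans (sqr_sum_le _))//.
have {E2} : m b * r b b' * D *
    \sum_(n < N.+1) (h (lineconf b n) - h (lineconf b' n)) ^+ 2 <=
    2 * energy rate wt h h.
  rewrite (le_trans _ E2)// mulr_sumr; apply: ler_sum => n _.
  have nN : (n <= N)%N by rewrite -ltnS.
  rewrite -[in leRHS]opprB sqrrN ler_wpM2r ?sqr_ge0//.
  have occE z := occ_lineconf x y b z nN.
  rewrite (@le_trans _ _ (wt (lineconf b n) * ((occ (lineconf b n) b)%:R *
      (d + (occ (lineconf b n) b')%:R) * r b b')))//.
    rewrite (conductance r m d bb' occE) ler_wpM2l ?(ltW c0)//.
    exact: background_weight.
  rewrite ler_wpM2l ?(config_weight_ge0 m_ge0 d_ge0)// inclusion_rate_moved.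
  have mv : moved (lineconf b n) (lineconf b' n) b b'.
    by apply/movedP => // z; rewrite !occ_lineconf// addnAC.
  rewrite (bigD1 b)//= (bigD1 b')//= mv mul1r -addrA lerDl addr_ge0//.
    by apply: sumr_ge0 => z _; rewrite !mulr_ge0// addr_ge0.
  by do 2![apply: sumr_ge0 => ? _]; rewrite !mulr_ge0// addr_ge0.
move=> H; have {}H : \sum_(n < N.+1) (h (lineconf b n) - h (lineconf b' n)) ^+ 2
    <= (m b * r b b' * D)^-1 * (2 * energy rate wt h h).
  by rewrite ler_pdivlMl ?(mulr_gt0 c0 D0)//.
apply: le_trans (ler_wpM2l (ler0n _ _) H) _.
apply: le_of_eq; field.
by have := gt_eqF c0; rewrite mulf_eq0 => /norP[-> ->]; rewrite gt_eqF.
Qed.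

End Edge.

Section Resistance.
Variables (R : realType) (S : finType) (r : S -> S -> R) (m : S -> R).
Hypothesis r_ge0 : forall x y, 0 <= r x y.
Hypothesis r_irr : irreducible r.
Hypothesis m_ge0 : forall x, 0 <= m x.
Hypothesis m_rev : reversible r m.
Hypothesis m_max : exists x, m x = 1.
Notation wt d := (fun eta => config_weight m d (occ eta)).

Lemma stationary_gt0 b : 0 < m b.
Proof.
have [x mx] := m_max; have /connectP[p] := r_irr x b.
have : 0 < m x by rewrite mx.
elim: p x {mx} => [x mx _ -> //|a p IHp x mx /= /andP[rxa pa] bE].
apply: (IHp a) => //; rewrite lt_neqAle m_ge0 andbT eq_sym.
apply/eqP => ma; have := m_rev x a; rewrite ma mul0r => /eqP.
by rewrite mulf_eq0 !gt_eqF.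
Qed.

Variables (x y : S).
Hypothesis mx : m x = 1.
Hypothesis my : m y = 1.
Hypothesis xy : x != y.

(** The exponent [j] is the loss in conductance, in powers of [d / N]. Stating
    closeness for the sums over all backgrounds, instead of for the two ends,
    makes it an equivalence relation on intermediate sites, so that paths can be
    composed edge by edge. *)
Definition line_close (j : nat) (b b' : S) := exists2 C : R, 0 <= C &
  forall d N (h : config S N.+1 -> R), 0 < d -> d <= 1 ->
    (\sum_(n < N.+1) h (lineconf N x y b n) -
     \sum_(n < N.+1) h (lineconf N x y b' n)) ^+ 2 <=
    C * (N.+1%:R / (d ^+ 2 * (d / N.+1%:R) ^+ j)) *
    energy (inclusion_rate r d (N := N.+1)) (wt d) h h.

Lemma energy_inclusion_ge0 d N (h : config S N -> R) : 0 <= d ->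
  0 <= energy (inclusion_rate r d (N := N)) (wt d) h h.
Proof.
move=> d0; apply: energy_ge0 => [eta|]; first exact: config_weight_ge0.
exact: inclusion_rate_ge0.
Qed.

Lemma close_edge j b b' : 0 < r b b' ->
  (#|([set x; y] :\: [set b; b'])%SET| <= j)%N -> line_close j b b'.
Proof.
move=> rb kj; have c0 : 0 < m b * r b b' by rewrite mulr_gt0 ?stationary_gt0.
exists (2 / (m b * r b b')); first by rewrite divr_ge0// ltW.
move=> d N h d0 d1; have E0 := energy_inclusion_ge0 h (ltW d0).
have [b'E|bb'] := eqVneq b' b.
  subst b'; rewrite subrr expr0n/=; apply: mulr_ge0 => //; apply: mulr_ge0.
    by rewrite divr_ge0// ltW.
  by rewrite divr_ge0// mulr_ge0// ?exprn_ge0// ?divr_ge0// ltW.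
apply: le_trans (edge_bound r_ge0 m_ge0 d0 d1 mx my xy h c0 bb') _.
apply: ler_wpM2r => //; apply: ler_wpM2l; first by rewrite divr_ge0// ltW.
apply: ler_wpM2l => //; rewrite lef_pV2 ?posrE ?mulr_gt0 ?exprn_gt0 ?divr_gt0//.
rewrite ler_wpM2l ?exprn_ge0 ?(ltW d0)//.
apply: ler_wiXn2l => //; first by rewrite divr_ge0// ltW.
by rewrite ler_pdivrMr// mul1r (le_trans d1)// ler1n.
Qed.

Lemma close_refl j b : line_close j b b.
Proof.
exists 0 => // d N h d0 d1; by rewrite subrr expr0n/= !mul0r.
Qed.

Lemma close_trans j b c e :
  line_close j b c -> line_close j c e -> line_close j b e.
Proof.
move=> [C1 C10 H1] [C2 C20 H2]; exists (2 * (C1 + C2)).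
  by rewrite mulr_ge0// addr_ge0.
move=> d N h d0 d1; have := H1 d N h d0 d1; have := H2 d N h d0 d1.
set t := _ / _; set E := energy _ _ _ _ => h2 h1.
set u := \sum_(n < N.+1) h (lineconf N x y b n) in h1 *.
set v := \sum_(n < N.+1) h (lineconf N x y c n) in h1 h2 *.
set w := \sum_(n < N.+1) h (lineconf N x y e n) in h2 *.
have := sqr_ge0 ((u - v) - (v - w)); nra.
Qed.

Lemma close_irreducible : line_close 2 x y.
Proof.
have /connectP[p] := r_irr x y.
elim: p {1 2 3}x => [z _ -> |a p IHp z /= /andP[rza pa] yE].
  exact: close_refl.
apply: close_trans (IHp a pa yE); apply: close_edge => //.
apply: leq_trans (subset_leq_card (finset.subsetDl _ _)) _.
by rewrite cards2; case: eqP.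
Qed.

Lemma close_common_neighbour a : 0 < r x a -> 0 < r y a -> line_close 1 x y.
Proof.
move=> rxa rya.
have ray : 0 < r a y.
  rewrite lt_neqAle r_ge0 andbT eq_sym; apply/eqP => ray0.
  have := m_rev y a; rewrite ray0 mulr0 my mul1r => rya0.
  by rewrite rya0 ltxx in rya.
apply: (@close_trans _ _ a); apply: close_edge => //.
  rewrite -(cards1 y); apply: subset_leq_card; apply/fintype.subsetP => z.
  by rewrite !inE => /andP[/norP[/negPf ->]].
rewrite -(cards1 x); apply: subset_leq_card; apply/fintype.subsetP => z.
by rewrite !inE => /andP[/norP[_ /negPf ->]]; rewrite orbF.
Qed.

Lemma close_neighbour : 0 < r x y -> line_close 0 x y.
Proof.
by move=> rxy; apply: close_edge => //; rewrite finset.setDv cards0.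
Qed.

Lemma close_xi j : line_close j x y -> exists2 C : R, 0 <= C &
  forall d N (h : config S N -> R), 0 < d -> d <= 1 -> (0 < N)%N ->
    (h (xi N x) - h (xi N y)) ^+ 2 <=
    C * (N%:R / (d ^+ 2 * (d / N%:R) ^+ j)) *
    energy (inclusion_rate r d (N := N)) (wt d) h h.
Proof.
move=> [C C0 H]; exists C => // d [//|N] h d0 d1 _.
rewrite -(lineconf_ends xy); exact: H.
Qed.

End Resistance.

(** * Upper bounds for the energy: cutoff functions *)

Lemma pigeonhole (S : finType) (N : nat) (V : pred S) (g : S -> nat) (c : nat) :
  (0 < N)%N ->
  (N <= c * \sum_(z | V z) g z)%N -> exists2 z, V z & (N <= c * #|S| * g z)%N.
Proof.
move=> N_gt0.
move=> Nc; apply/exists_inP; apply: contraPT (Nc) => /exists_inPn small.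
apply/negP; rewrite -ltnNge.
have S0 : (0 < #|S|)%N.
  rewrite lt0n; apply: contraTneq N_gt0 => S0; move: Nc; rewrite big1 ?muln0.
    by rewrite leqn0 => /eqP ->.
  by move=> z; have := ltn_ord (enum_rank z); rewrite {2}S0.
rewrite -(ltn_pmul2l S0).
apply: (@leq_ltn_trans (\sum_(z | V z) N.-1)).
  rewrite !big_distrr /=; apply: leq_sum => z /small; rewrite -ltnNge.
  by rewrite mulnA [(#|S| * c)%N]mulnC; lia.
rewrite sum_nat_const; apply: (@leq_ltn_trans (#|S| * N.-1)).
  by rewrite leq_mul2r max_card orbT.
by rewrite ltn_pmul2l// prednK.
Qed.

Lemma leqS_double n : (0 < n)%N -> (n.+1 <= 2 * n)%N.
Proof. lia. Qed.

(** The two ranges are those in which the clamp of [cutoff] is constant. *)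
Lemma flat_ranges n n' c N : (12 <= N)%N -> (n + c = N)%N ->
  (n' = n.+1 \/ n = n'.+1)%N -> (4 * n < N)%N || (4 * c < N)%N ->
  ((3 * n <= N /\ 3 * n' <= N) \/ (2 * N <= 3 * n /\ 2 * N <= 3 * n'))%N.
Proof. by move=> N12 nc nn' /orP[] h; [left|right]; lia. Qed.

Lemma ler_pMbool (R : numDomainType) (X : R) (b : bool) :
  0 <= X -> X * b%:R <= X.
Proof. by case: b => X0; rewrite ?mulr1// mulr0. Qed.

Section UpperBound.
Variables (R : realType) (S : finType) (r : S -> S -> R) (m : S -> R).
Hypothesis r_ge0 : forall x y, 0 <= r x y.
Hypothesis m_ge0 : forall x, 0 <= m x.
Hypothesis m_le1 : forall x, m x <= 1.
Variables (d : R) (N : nat).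
Hypothesis d_gt0 : 0 < d.
Hypothesis d_le1 : d <= 1.
Hypothesis N_gt0 : (0 < N)%N.
Hypothesis rise_le2 : rise d N <= 2.
Implicit Types (eta zeta : config S N) (x y z u v : S).

Let d_ge0 := ltW d_gt0.
Let N0 : 0 < N%:R :> R. Proof. by rewrite ltr0n. Qed.
Notation wt := (fun eta : config S N => config_weight m d (occ eta)).

Lemma site_weight_le z n : site_weight m d z n <= weight d n.
Proof. by rewrite /site_weight ler_piMl ?weight_ge0// exprn_ile1. Qed.

Lemma sum_site_weight z : \sum_(n < N.+1) site_weight m d z n <= 2.
Proof.
rewrite (le_trans _ rise_le2)// -sum_weight; apply: ler_sum => n _.
exact: site_weight_le.
Qed.

Lemma natr_site_weight z n : (n <= N)%N ->
  n%:R * site_weight m d z n <= 2 * d * m z ^+ n.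
Proof.
move=> nN; rewrite /site_weight mulrCA mulrC ler_wpM2r ?exprn_ge0//.
by rewrite (le_trans (natr_weight_le d_ge0 nN))// mulrC ler_wpM2r.
Qed.

Lemma shift_site_weight z n : (n <= N)%N ->
  (d + n%:R) * site_weight m d z n <= 2 * d * m z ^+ n.
Proof.
move=> nN; rewrite /site_weight mulrCA mulrC ler_wpM2r ?exprn_ge0//.
by rewrite (le_trans (shift_weight_le d_ge0 nN))// mulrC ler_wpM2r.
Qed.

Lemma big_site_weight k z n : (n <= N)%N -> (N <= k * n)%N ->
  site_weight m d z n <= 2 * k%:R * (d / N%:R).
Proof.
move=> nN Nkn; rewrite mulrA ler_pdivlMr// mulrC.
apply: (@le_trans _ _ (k%:R * (n%:R * site_weight m d z n))).
  rewrite mulrA -natrM ler_wpM2r ?site_weight_ge0//.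
  by rewrite ler_nat.
rewrite [2 * _]mulrC -mulrA ler_wpM2l// (le_trans (natr_site_weight z nN))//.
by rewrite ler_piMr ?mulr_ge0// exprn_ile1.
Qed.

Lemma prod_indicator z1 a (X : R) :
  \prod_(z | z != z1) (if z == a then X else 1) = if a == z1 then 1 else X.
Proof.
have [->|az] := eqVneq a z1.
  by rewrite big1// => z /negPf->.
rewrite (bigD1 a)//= eqxx big1 ?mulr1// => z /andP[_ /negPf->] //.
Qed.

Lemma prod_at a (X : S -> R) : \prod_z (if z == a then X z else 1) = X a.
Proof.
by rewrite (bigD1 a)//= eqxx big1 ?mulr1// => z /negPf->.
Qed.

(** [Q] bounds the geometric sums of the [m z], [z \in S0 m]; an occupation
    number [n] counts as macroscopic if [N <= k * n]. *)
Section BulkPair.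
Variables (Q : R) (k : nat).
Hypothesis Q_ge1 : 1 <= Q.
Hypothesis QS0 : forall z, z \in S0 m -> \sum_(n < N.+1) m z ^+ n <= Q.
Hypothesis k_gt0 : (0 < k)%N.

(** Being macroscopic, [z1] and [z2] cost factors [d / N] and [d], the latter
    after summation over the position of the split; the factor [occ eta u] (or
    [d + occ eta v]) multiplies this by [N] if [u = z1] (or [v = z2]).
    Otherwise [u] (or [v]) costs a further factor [d], and the sum over its
    occupation number gives back [N] only if it is outside [S0]. *)
Lemma bulk_pair (z1 z2 u v : S) :
  z1 \notin S0 m -> z2 \notin S0 m -> z1 != z2 -> u != v -> u != z2 -> v != z1 ->
  \sum_eta ((N <= k * occ eta z1)%N && (N <= k * occ eta z2)%N)%:R *
     (wt eta * ((occ eta u)%:R * (d + (occ eta v)%:R))) <=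
  2 ^+ #|S| * (8 * k%:R * Q) * (16 * k%:R * Q) * (d ^+ 2 * N%:R) *
  (d / N%:R) ^+ ((u \in S0 m) + (v \in S0 m)).
Proof.
move=> z1S z2S z12 uv uz2 vz1.
pose Phi z n : R := site_weight m d z n * (if z == u then n%:R else 1) *
  (if z == v then d + n%:R else 1) *
  (if (z == z1) || (z == z2) then (N <= k * n)%N%:R else 1).
have Phi0 z n : 0 <= Phi z n.
  rewrite /Phi; apply: mulr_ge0; last by case: ifP.
  apply: mulr_ge0; last by case: ifP => // _; rewrite addr_ge0.
  by apply: mulr_ge0; [exact: site_weight_ge0|case: ifP].
pose G z : R := if z \in S0 m then Q else 2 * N%:R.
have mG z : \sum_(n < N.+1) m z ^+ n <= G z.
  rewrite /G; case: ifPn => [/QS0//|_].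
  apply: (@le_trans _ _ (\sum_(n < N.+1) (1 : R))).
    by apply: ler_sum => n _; rewrite exprn_ile1.
  by rewrite sumr_const card_ord -natrM ler_nat leqS_double.
pose M1 : R := if u == z1 then 2 * d else 2 * k%:R * (d / N%:R).
pose M2 : R := if v == z2 then 2 * (N%:R * d) else 2 * k%:R * d.
have PhiM1 n : (n <= N)%N -> Phi z1 n <= M1.
  move=> nN; rewrite /Phi eqxx/= [z1 == v]eq_sym (negPf vz1) mulr1 /M1.
  rewrite [z1 == u]eq_sym; case: eqVneq => [uz1|_].
    rewrite [_ * n%:R]mulrC (@le_trans _ _ (2 * d * m z1 ^+ n))//.
      rewrite (le_trans _ (natr_site_weight _ nN))// ler_pMbool//.
      by apply: mulr_ge0 => //; exact: site_weight_ge0.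
    by rewrite ler_piMr ?mulr_ge0// exprn_ile1.
  rewrite mulr1; have [h|h] := boolP (N <= k * n)%N.
    by rewrite mulr1; exact: big_site_weight.
  by rewrite mulr0 !mulr_ge0 ?divr_ge0.
have NS : N.+1%:R <= 2 * N%:R :> R by rewrite -natrM ler_nat leqS_double.
have PhiS z : z != z1 -> \sum_(n < N.+1) Phi z n <=
    2 * (if z == z2 then M2 else 1) * (if z == u then 2 * d * G u else 1) *
    (if z == v then (if v == z2 then 1 else 2 * d * G v) else 1).
  move=> zz1; rewrite /Phi (negPf zz1) /=.
  have [->|zz2] := eqVneq z z2.
    rewrite [z2 == u]eq_sym (negPf uz2) [z2 == v]eq_sym /M2 mulr1.
    have [vz2|_] := eqVneq v z2.
      rewrite !mulr1.
      apply: (@le_trans _ _ (\sum_(n < N.+1) (2 * d))).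
        apply: ler_sum => n _; rewrite mulr1 -vz2.
        have nN : (n <= N)%N by rewrite -ltnS.
        apply: (@le_trans _ _ ((d + n%:R) * site_weight m d v n)).
          rewrite [leRHS]mulrC ler_pMbool//; apply: mulr_ge0.
            exact: site_weight_ge0.
          by rewrite addr_ge0.
        rewrite (le_trans (shift_site_weight _ nN))// ler_piMr ?mulr_ge0//.
        by rewrite exprn_ile1.
      rewrite sumr_const card_ord -[leLHS]mulr_natl.
      by rewrite mulrCA ler_wpM2l// mulrA ler_wpM2r.
    rewrite !mulr1.
    apply: (@le_trans _ _ (\sum_(n < N.+1) (2 * k%:R * (d / N%:R)))).
      apply: ler_sum => n _; rewrite !mulr1.
      have nN : (n <= N)%N by rewrite -ltnS.
      have [h|h] := boolP (N <= k * n)%N.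
        by rewrite mulr1; exact: big_site_weight.
      by rewrite mulr0 !mulr_ge0 ?divr_ge0.
    rewrite sumr_const card_ord -[leLHS]mulr_natl.
    rewrite (le_trans (ler_wpM2r _ NS)) ?mulr_ge0 ?divr_ge0//.
    by apply: le_of_eq; field; rewrite gt_eqF.
  rewrite mulr1; have [zu|zu] := eqVneq z u.
    rewrite zu (negPf uv) !mulr1.
    apply: (@le_trans _ _ (2 * d * G u)).
      apply: (@le_trans _ _ (\sum_(n < N.+1) 2 * d * m u ^+ n)).
        apply: ler_sum => n _; rewrite !mulr1 mulrC natr_site_weight//.
        by rewrite -ltnS.
      by rewrite -mulr_sumr ler_wpM2l ?mulr_ge0.
    rewrite ler_peMl// ?ler1n// !mulr_ge0// /G; case: ifP => // _.
    exact: le_trans Q_ge1.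
  rewrite mulr1; have [zv|zv] := eqVneq z v.
    rewrite -zv (negPf zz2).
    apply: (@le_trans _ _ (2 * d * G z)).
      apply: (@le_trans _ _ (\sum_(n < N.+1) 2 * d * m z ^+ n)).
        apply: ler_sum => n _; rewrite !mulr1 mulrC shift_site_weight//.
        by rewrite -ltnS.
      by rewrite -mulr_sumr ler_wpM2l ?mulr_ge0.
    rewrite ler_peMl// ?ler1n// !mulr_ge0// /G; case: ifP => // _.
    exact: le_trans Q_ge1.
  rewrite !mulr1; under eq_bigr do rewrite !mulr1.
  exact: sum_site_weight.
have lhsE : \sum_eta ((N <= k * occ eta z1)%N && (N <= k * occ eta z2)%N)%:R *
     (wt eta * ((occ eta u)%:R * (d + (occ eta v)%:R))) =
   \sum_(eta : config S N) \prod_z Phi z (occ eta z).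
  apply: eq_bigr => eta _.
  have -> : \prod_z Phi z (occ eta z) = config_weight m d (occ eta) *
      \prod_z (if z == u then (occ eta z)%:R else 1) *
      \prod_z (if z == v then d + (occ eta z)%:R else 1) *
      \prod_z (if (z == z1) || (z == z2) then (N <= k * occ eta z)%N%:R else 1).
    by rewrite -!big_split.
  rewrite !prod_at.
  have -> : \prod_z (if (z == z1) || (z == z2) then (N <= k * occ eta z)%N%:R
      else 1) = ((N <= k * occ eta z1)%N && (N <= k * occ eta z2)%N)%:R :> R.
    rewrite (bigD1 z1)//= (bigD1 z2)/=; last by rewrite eq_sym.
    rewrite !eqxx orbT/= big1 ?mulr1; first by rewrite -natrM mulnb.
    by move=> z /andP[/negPf-> /negPf->].
  by rewrite mulrC !mulrA.
rewrite lhsE; apply: le_trans (sum_config_le Phi0 PhiM1) _.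
have k1 : 1 <= k%:R :> R by rewrite ler1n.
have kQ1 : 1 <= k%:R * Q by rewrite mulr_ege1.
have Q0 : 0 <= Q by exact: le_trans Q_ge1.
have dN0 : 0 <= d / N%:R by rewrite divr_ge0.
pose U : R := if u == z1 then 1 else 2 * d * G u.
pose V : R := if v == z2 then 1 else 2 * d * G v.
have G0 z : 0 <= G z by rewrite /G; case: ifP => // _; rewrite mulr_ge0.
have [M10 M20] : 0 <= M1 /\ 0 <= M2.
  by split; rewrite /M1 /M2; case: ifP => _; rewrite !mulr_ge0.
have [U0 V0] : 0 <= U /\ 0 <= V.
  by split; rewrite /U /V; case: ifP => _ //; rewrite !mulr_ge0.
have M1U : M1 * U <= (8 * k%:R * Q) * d * (d / N%:R) ^+ (u \in S0 m).
  rewrite /M1 /U /G; case: eqVneq => [->|_].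
    rewrite (negPf z1S) expr0 !mulr1 ler_wpM2r// -mulrA; nra.
  case: (u \in _); rewrite ?expr0 ?expr1.
    rewrite [leLHS](_ : _ = 4 * k%:R * Q * d * (d / N%:R)); last by ring.
    rewrite ler_wpM2r// ler_wpM2r// ler_wpM2r// ler_wpM2r// ler_nat//.
  rewrite [leLHS](_ : _ = 8 * k%:R * (d * d)); last by field; rewrite gt_eqF.
  rewrite mulr1 -!mulrA ler_wpM2l// ler_wpM2l//.
  by rewrite ler_wpM2r// (le_trans d_le1).
have M2V : M2 * V <= (16 * k%:R * Q) * (d * N%:R) * (d / N%:R) ^+ (v \in S0 m).
  have Nd0 : 0 <= N%:R * d by rewrite mulr_ge0.
  rewrite /M2 /V /G; case: eqVneq => [->|_].
    rewrite (negPf z2S) expr0 !mulr1 [d * _]mulrC ler_wpM2r// -mulrA; nra.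
  case: (v \in _); rewrite ?expr0 ?expr1.
    rewrite [leLHS](_ : _ = 4 * (k%:R * Q * d * d)); last by ring.
    rewrite [leRHS](_ : _ = 16 * (k%:R * Q * d * d)); last first.
      by field; rewrite gt_eqF.
    by rewrite ler_wpM2r ?mulr_ge0// ler_nat.
  rewrite [leLHS](_ : _ = 8 * (k%:R * (N%:R * d)) * d); last by ring.
  rewrite [leRHS](_ : _ = 16 * (k%:R * (N%:R * d)) * Q); last by ring.
  have kNd : 0 <= k%:R * (N%:R * d) by rewrite mulr_ge0.
  rewrite ler_pM ?mulr_ge0//; first by rewrite ler_wpM2r// ler_nat.
  exact: le_trans Q_ge1.
apply: (@le_trans _ _ (M1 * (2 ^+ #|S| * M2 * U * V))).
  rewrite ler_wpM2l//.
  apply: (@le_trans _ _ (\prod_(z | z != z1)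
     (2 * (if z == z2 then M2 else 1) * (if z == u then 2 * d * G u else 1) *
     (if z == v then V else 1)))).
    apply: ler_prod => z zz1; rewrite sumr_ge0 ?PhiS// => n _; exact: Phi0.
  rewrite !big_split/= !prod_indicator eq_sym (negPf z12) (negPf vz1).
  rewrite -/U ler_wpM2r// ler_wpM2r// ler_wpM2r//.
  rewrite prodr_const ler_eXn2l ?ltr1n//; exact: max_card.
rewrite exprD [leLHS](_ : _ = 2 ^+ #|S| * ((M1 * U) * (M2 * V))); last by ring.
apply: (@le_trans _ _ (2 ^+ #|S| *
  (((8 * k%:R * Q) * d * (d / N%:R) ^+ (u \in S0 m)) *
   ((16 * k%:R * Q) * (d * N%:R) * (d / N%:R) ^+ (v \in S0 m))))).
  by rewrite ler_wpM2l ?exprn_ge0// ler_pM// mulr_ge0.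
by apply: le_of_eq; ring.
Qed.

Definition split_between (V : {set S}) eta : bool :=
  (N <= 4 * \sum_(z | z \in V) occ eta z)%N &&
  (N <= 4 * \sum_(z | z \notin V) occ eta z)%N.

(** A macroscopic number of particles at a site of [S0] has a weight that beats
    the number of configurations and every power of [d] and [N] in use. *)
Hypothesis S0_negligible : forall z n, z \in S0 m -> (N <= k * n)%N ->
  N.+1%:R ^+ #|S| * (2 * N%:R ^+ 3) * m z ^+ n <= d ^+ 4.
Hypothesis kE : k = (4 * #|S|)%N.

Lemma card_config : (#|{: config S N}| <= N.+1 ^ #|S|)%N.
Proof.
rewrite -[in leqRHS](card_ord N.+1) -card_ffun.
exact: (leq_card (@config_val S N) val_inj).
Qed.

Lemma config_weight_le_site eta z : wt eta <= m z ^+ occ eta z.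
Proof.
rewrite /config_weight (bigD1 z)//=.
have le1 t n : site_weight m d t n <= 1.
  by rewrite (le_trans (site_weight_le _ _))// weight_le1.
have p1 : \prod_(i | i != z) site_weight m d i (occ eta i) <= 1.
  apply: prodr_ile1 => i _; rewrite le1 andbT; exact: site_weight_ge0.
rewrite (le_trans (ler_piMr _ p1)) ?site_weight_ge0//.
by rewrite /site_weight ler_piMr ?exprn_ge0// weight_le1.
Qed.

Lemma S0_bulk_term eta z u v : z \in S0 m -> (N <= k * occ eta z)%N ->
  wt eta * ((occ eta u)%:R * (d + (occ eta v)%:R)) <=
  d ^+ 4 / N%:R / N.+1%:R ^+ #|S|.
Proof.
move=> zS Nz; rewrite ler_pdivlMr ?exprn_gt0// ler_pdivlMr//.
have := S0_negligible zS Nz; apply: le_trans.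
apply: (@le_trans _ _ (m z ^+ occ eta z * (N%:R * (2 * N%:R)) *
    N.+1%:R ^+ #|S| * N%:R)).
  rewrite ler_wpM2r// ler_wpM2r ?exprn_ge0// ler_pM//.
  - exact: config_weight_ge0.
  - by rewrite mulr_ge0// addr_ge0.
  - exact: config_weight_le_site.
  - rewrite ler_pM ?addr_ge0// ?ler_nat ?occ_le// mulr_natl mulr2n lerD//.
      by rewrite (le_trans d_le1)// ler1n.
    by rewrite ler_nat occ_le.
by apply: le_of_eq; ring.
Qed.

Definition pair_const : R := 2 ^+ #|S| * (8 * k%:R * Q) * (16 * k%:R * Q).

(** By the pigeonhole principle each side contains a macroscopic occupation
    number. Summing over the two sites that carry them reduces to [bulk_pair],
    unless one of them is in [S0]. *)
Lemma split_sum (V : {set S}) u v j : u \in V -> v \notin V ->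
  (j <= (u \in S0 m) + (v \in S0 m))%N ->
  \sum_eta (split_between V eta)%:R *
     (wt eta * ((occ eta u)%:R * (d + (occ eta v)%:R))) <=
  (#|S|%:R ^+ 2 * pair_const + 1) * (d ^+ 2 * N%:R * (d / N%:R) ^+ j).
Proof.
move=> uV vV ju; pose X eta := wt eta * ((occ eta u)%:R * (d + (occ eta v)%:R)).
have X0 eta : 0 <= X eta.
  apply: mulr_ge0; first exact: config_weight_ge0.
  by rewrite mulr_ge0// addr_ge0.
pose good (z1 z2 : S) :=
  [&& z1 \in V, z1 \notin S0 m, z2 \notin V & z2 \notin S0 m].
pose tiny : R := d ^+ 4 / N%:R / N.+1%:R ^+ #|S|.
have tiny0 : 0 <= tiny by rewrite !divr_ge0 ?exprn_ge0.
pose ind z1 z2 eta : R :=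
  ((N <= k * occ eta z1)%N && (N <= k * occ eta z2)%N)%:R.
have term0 (z1 z2 : S) eta : 0 <= (good z1 z2)%:R * (ind z1 z2 eta * X eta).
  by rewrite mulr_ge0// mulr_ge0.
have pointwise eta : (split_between V eta)%:R * X eta <=
    \sum_z1 \sum_z2 (good z1 z2)%:R * (ind z1 z2 eta * X eta) + tiny.
  have [/andP[/(pigeonhole N_gt0)[z1 z1V N1] /(pigeonhole N_gt0)[z2 z2V N2]]|_] :=
      boolP (split_between V eta); last first.
    rewrite mul0r addr_ge0// sumr_ge0// => z1 _.
    by apply: sumr_ge0 => z2 _; exact: term0.
  rewrite -kE in N1 N2; rewrite mul1r.
  have sum0 : 0 <= \sum_z1 \sum_z2 (good z1 z2)%:R * (ind z1 z2 eta * X eta).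
    by do 2![apply: sumr_ge0 => ? _]; exact: term0.
  have [z1S|z1S] := boolP (z1 \in S0 m).
    by rewrite (le_trans (S0_bulk_term u v z1S N1))// lerDr.
  have [z2S|z2S] := boolP (z2 \in S0 m).
    by rewrite (le_trans (S0_bulk_term u v z2S N2))// lerDr.
  have gi : (good z1 z2)%:R * (ind z1 z2 eta * X eta) = X eta.
    by rewrite /good z1V z1S z2V z2S /ind N1 N2 !mul1r.
  rewrite (bigD1 z1)//= (bigD1 z2)//= gi -!addrA lerDl.
  apply: addr_ge0; [|apply: addr_ge0 => //].
    by apply: sumr_ge0 => ? _; exact: term0.
  by do 2![apply: sumr_ge0 => ? _]; exact: term0.
apply: le_trans (ler_sum _ (fun eta _ => pointwise eta)) _.
have dN0 : 0 <= d / N%:R by rewrite divr_ge0.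
have dN1 : d / N%:R <= 1 by rewrite ler_pdivrMr// mul1r (le_trans d_le1)// ler1n.
have k0 : 0 <= pair_const.
  have Q0 : 0 <= Q by exact: le_trans Q_ge1.
  by rewrite !mulr_ge0 ?exprn_ge0.
have dj i : (j <= i)%N -> d ^+ 2 * N%:R * (d / N%:R) ^+ i <=
    d ^+ 2 * N%:R * (d / N%:R) ^+ j.
  move=> ji; rewrite ler_wpM2l ?mulr_ge0 ?exprn_ge0//.
  exact: ler_wiXn2l.
have D0 : 0 <= d ^+ 2 * N%:R * (d / N%:R) ^+ j.
  by rewrite mulr_ge0 ?exprn_ge0// mulr_ge0 ?exprn_ge0.
rewrite big_split/= mulrDl mul1r lerD//.
  rewrite exchange_big/=; under eq_bigr do rewrite exchange_big/=.
  apply: (@le_trans _ _ (\sum_(z1 : S) \sum_(z2 : S)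
      pair_const * (d ^+ 2 * N%:R * (d / N%:R) ^+ j))); last first.
    by rewrite !sumr_const; apply: le_of_eq; ring.
  apply: ler_sum => z1 _; apply: ler_sum => z2 _; rewrite -mulr_sumr.
  have [/and4P[z1V z1S z2V z2S]|_] := boolP (good z1 z2); last first.
    by rewrite mul0r mulr_ge0.
  rewrite mul1r; have neq a b : a \in V -> b \notin V -> a != b.
    by move=> aV; apply: contraNneq => <-.
  apply: le_trans (bulk_pair z1S z2S (neq _ _ z1V z2V) (neq _ _ uV vV)
    (neq _ _ uV z2V) _) _; first by rewrite eq_sym neq.
  by rewrite -mulrA ler_wpM2l// dj.
rewrite sumr_const -[leLHS]mulr_natl.
apply: (@le_trans _ _ (N.+1%:R ^+ #|S| * tiny)).
  by rewrite ler_wpM2r// -natrX ler_nat card_config.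
apply: le_trans (dj 2 _); last first.
  by apply: leq_trans ju _; case: (_ \in _); case: (_ \in _).
rewrite /tiny; apply: le_of_eq; field.
by rewrite ?nat1r ?natr1 ?expf_neq0 ?gt_eqF.
Qed.

(** A function of the fraction of particles in [V] that is flat near [0] and
    [1], so that only configurations split between [V] and its complement
    contribute to its energy. *)
Definition cutoff (V : {set S}) eta : R :=
  Num.min 1 (Num.max 0 (3 * (\sum_(z | z \in V) occ eta z)%:R / N%:R - 1)).

Lemma cutoff_ge0 V eta : 0 <= cutoff V eta.
Proof. by rewrite /cutoff le_min ler01 le_max lexx. Qed.

Lemma cutoff_le1 V eta : cutoff V eta <= 1.
Proof. by rewrite /cutoff ge_min lexx. Qed.

Lemma sum_occ_xi (V : {set S}) x :
  (\sum_(z | z \in V) occ (xi N x) z = (x \in V) * N)%N.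
Proof.
have [xV|xV] := boolP (x \in V).
  rewrite (bigD1 x)//= occ_xi eqxx big1 ?addn0// => z /andP[_ /negPf zx].
  by rewrite occ_xi zx.
rewrite big1// => z zV; rewrite occ_xi; case: eqP => // zx.
by rewrite -zx zV in xV.
Qed.

Lemma cutoff_xi V x : cutoff V (xi N x) = (x \in V)%:R.
Proof.
rewrite /cutoff sum_occ_xi; case: (x \in V).
  rewrite mul1n mulfK ?gt_eqF//; apply/min_idPl.
  rewrite le_max; apply/orP; right; lra.
by rewrite mul0n mulr0 mul0r sub0r max_l// min_r.
Qed.

Lemma split_betweenC V eta : split_between (~: V)%SET eta = split_between V eta.
Proof.
rewrite /split_between andbC; congr (_ && _); congr (_ <= 4 * _)%N;
  by apply: eq_bigl => z; rewrite inE// negbK.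
Qed.

Hypothesis N_ge12 : (12 <= N)%N.

Lemma clamp_lip (s t : R) :
  (Num.min 1 (Num.max 0 s) - Num.min 1 (Num.max 0 t)) ^+ 2 <= (s - t) ^+ 2.
Proof.
have clamp (q : R) : exists2 c, Num.min 1 (Num.max 0 q) = c &
    [\/ c = 0 /\ q <= 0, c = q /\ 0 <= q <= 1 | c = 1 /\ 1 <= q].
  exists (Num.min 1 (Num.max 0 q)) => //.
  have [q0|q0] := leP q 0; first by apply: Or31; split=> //; rewrite min_r.
  have [q1|q1] := leP q 1.
    by apply: Or32; split; rewrite ?min_r ?(ltW q0).
  by apply: Or33; split; rewrite ?min_l ?ltW.
have sq := sqr_ge0 (s - t).
have [a ->] := clamp s; have [b ->] := clamp t.
by move=> [[-> t0]|[-> /andP[t0 t1]]|[-> t1]] [[-> s0]|[-> /andP[s0 s1]]|[-> s1]];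
  nra.
Qed.

(** One jump moves the argument of the clamp by [3 / N], and for [12 <= N] this
    cannot leave the flat parts of the clamp when less than a quarter of the
    particles is on one side. *)
Lemma cutoff_jump V eta zeta u v : moved eta zeta u v ->
  (cutoff V zeta - cutoff V eta) ^+ 2 <=
  ((u \in V) != (v \in V))%:R * (split_between V eta)%:R * (3 / N%:R) ^+ 2.
Proof.
move=> mv; have vu : v != u by case/andP: mv.
have /movedP := mv; move=> /(_ vu) mvE.
set n := (\sum_(z | z \in V) occ eta z)%N.
set n' := (\sum_(z | z \in V) occ zeta z)%N.
have one a : (\sum_(z | z \in V) (z == a) = (a \in V))%N.
  have [aV|aV] := boolP (a \in V).
    by rewrite (bigD1 a)//= eqxx big1 ?addn0// => z /andP[_ /negPf->].
  by rewrite big1// => z zV; case: eqP => // za; rewrite -za zV in aV.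
have nn' : (n' + (u \in V) = n + (v \in V))%N.
  by rewrite -!one -!big_split/=; apply: eq_bigr.
have nC : (n + \sum_(z | z \notin V) occ eta z = N)%N.
  by rewrite -[RHS](sum_occ eta) [in RHS](bigID (mem V)).
have E0 : n' = n -> (cutoff V zeta - cutoff V eta) ^+ 2 = 0.
  by rewrite /cutoff -/n -/n' => ->; rewrite subrr expr0n.
have [uv|uv] /= := eqVneq (u \in V) (v \in V).
  by rewrite !mul0r E0//; move: nn'; rewrite uv => /addIn.
have n1 : (n' = n.+1 \/ n = n'.+1)%N.
  by move: nn' uv; case: (u \in V); case: (v \in V) => //=; lia.
rewrite mul1r; have [sp|sp] := boolP (split_between V eta).
  rewrite mul1r (le_trans (clamp_lip _ _))// -/n -/n'.
  have -> : 3 * n'%:R / N%:R - 1 - (3 * n%:R / N%:R - 1) =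
      (n'%:R - n%:R) * (3 / N%:R) :> R by ring.
  rewrite exprMn ler_piMl ?sqr_ge0//.
  by case: n1 => ->; rewrite -natr1; nra.
rewrite mul0r /cutoff -/n -/n'.
rewrite /split_between negb_and -!ltnNge in sp.
have [[low low']|[high high']] := flat_ranges N_ge12 nC n1 sp.
- have flat i : (3 * i <= N)%N -> Num.max 0 (3 * i%:R / N%:R - 1) = 0 :> R.
    move=> iN; apply/max_idPl; rewrite subr_le0 ler_pdivrMr// mul1r.
    by rewrite -natrM ler_nat.
  by rewrite (flat _ low) (flat _ low') subrr expr0n.
- have flat i : (2 * N <= 3 * i)%N ->
      Num.min 1 (Num.max 0 (3 * i%:R / N%:R - 1)) = 1 :> R.
    move=> iN; apply/min_idPl; rewrite le_max; apply/orP; right.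
    by rewrite lerBrDl ler_pdivlMr// -[1 + 1]/(2%:R) -!natrM ler_nat.
  by rewrite (flat _ high) (flat _ high') subrr expr0n.
Qed.

(** Each jump across the boundary of [V] changes [cutoff V] by at most [3 / N],
    and only at split configurations, whose total flow over a bond is bounded by
    [split_sum]. *)
Lemma energy_cutoff (V : {set S}) j :
  (forall u v, 0 < r u v -> (u \in V) != (v \in V) ->
     (j <= (u \in S0 m) + (v \in S0 m))%N) ->
  energy (inclusion_rate r d (N := N)) wt (cutoff V) (cutoff V) <=
  5 * (\sum_u \sum_v r u v) * (#|S|%:R ^+ 2 * pair_const + 1) *
  (d ^+ 2 / N%:R * (d / N%:R) ^+ j).
Proof.
move=> cross; set C := _ + 1.
pose X u v eta := wt eta * ((occ eta u)%:R * (d + (occ eta v)%:R)).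
have X0 u v eta : 0 <= X u v eta.
  apply: mulr_ge0; first exact: config_weight_ge0.
  by rewrite mulr_ge0// addr_ge0.
have C0 : 0 <= C.
  rewrite addr_ge0// mulr_ge0 ?exprn_ge0//.
  have Q0 : 0 <= Q by exact: le_trans Q_ge1.
  by rewrite !mulr_ge0 ?exprn_ge0.
set D := d ^+ 2 * N%:R * (d / N%:R) ^+ j.
have D0 : 0 <= D by rewrite !mulr_ge0 ?exprn_ge0 ?divr_ge0.
have step eta : \sum_zeta wt eta * inclusion_rate r d eta zeta *
      ((cutoff V zeta - cutoff V eta) * (cutoff V zeta - cutoff V eta)) <=
    \sum_u \sum_v r u v * (3 / N%:R) ^+ 2 *
      (((u \in V) != (v \in V))%:R * ((split_between V eta)%:R * X u v eta)).
  have -> : \sum_zeta wt eta * inclusion_rate r d eta zeta *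
      ((cutoff V zeta - cutoff V eta) * (cutoff V zeta - cutoff V eta)) =
    \sum_u \sum_v r u v * X u v eta * (\sum_zeta (moved eta zeta u v)%:R *
      (cutoff V zeta - cutoff V eta) ^+ 2).
    transitivity (\sum_zeta \sum_u \sum_v r u v * X u v eta *
        ((moved eta zeta u v)%:R * (cutoff V zeta - cutoff V eta) ^+ 2)).
      apply: eq_bigr => zeta _; rewrite inclusion_rate_moved mulr_sumr mulr_suml.
      apply: eq_bigr => u _; rewrite mulr_sumr mulr_suml.
      by apply: eq_bigr => v _; rewrite /X; ring.
    rewrite exchange_big; apply: eq_bigr => u _ /=.
    by rewrite exchange_big; apply: eq_bigr => v _ /=; rewrite mulr_sumr.
  apply: ler_sum => u _; apply: ler_sum => v _.
  rewrite [leRHS](_ : _ = r u v * X u v eta * (((u \in V) != (v \in V))%:R *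
    (split_between V eta)%:R * (3 / N%:R) ^+ 2)); last by ring.
  apply: ler_wpM2l; first exact: mulr_ge0.
  have [/existsP[zeta mv]|] := boolP [exists zeta, moved eta zeta u v].
    rewrite (bigD1 zeta)//= mv mul1r big1 ?addr0; first exact: cutoff_jump.
    move=> zeta' neq; case: (boolP (moved _ _ _ _)) => [mv'|]; rewrite ?mul0r//.
    by rewrite (moved_inj mv mv') eqxx in neq.
  rewrite negb_exists => /forallP nmv; rewrite big1; last first.
    by move=> zeta _; rewrite (negPf (nmv zeta)) mul0r.
  by rewrite !mulr_ge0 ?exprn_ge0 ?divr_ge0.
rewrite /energy; apply: (@le_trans _ _ (2^-1 *
    \sum_u \sum_v r u v * (3 / N%:R) ^+ 2 * (C * D))).
  rewrite ler_wpM2l//; apply: le_trans (ler_sum _ (fun eta _ => step eta)) _.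
  rewrite exchange_big; apply: ler_sum => u _ /=.
  rewrite exchange_big; apply: ler_sum => v _ /=.
  rewrite -mulr_sumr; have [ruv|ruv] := ltP 0 (r u v); last first.
    by have -> : r u v = 0; [apply/eqP; rewrite eq_le ruv r_ge0|rewrite !mul0r].
  rewrite ler_wpM2l ?mulr_ge0 ?exprn_ge0 ?divr_ge0// -mulr_sumr.
  have [uv|uv] := eqVneq (u \in V) (v \in V); first by rewrite mul0r mulr_ge0.
  rewrite mul1r; have juv := cross u v ruv uv.
  have [uV|uV] := boolP (u \in V).
    by apply: split_sum => //; move: uv; rewrite uV; case: (v \in V).
  under eq_bigr do rewrite -split_betweenC.
  apply: split_sum => //; rewrite inE//.
  by rewrite negbK; move: uv; rewrite (negPf uV); case: (v \in V).
have -> : \sum_u \sum_v r u v * (3 / N%:R) ^+ 2 * (C * D) =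
    (\sum_u \sum_v r u v) * ((3 / N%:R) ^+ 2 * (C * D)).
  rewrite mulr_suml; apply: eq_bigr => u _; rewrite mulr_suml.
  by apply: eq_bigr => v _; ring.
have r0 : 0 <= \sum_u \sum_v r u v by do 2![apply: sumr_ge0 => ? _].
rewrite [leLHS](_ : _ = 9 / 2 * ((\sum_u \sum_v r u v) * C *
  (d ^+ 2 / N%:R * (d / N%:R) ^+ j))); last first.
  by rewrite /D; field; rewrite gt_eqF.
rewrite [leRHS](_ : _ = 5 * ((\sum_u \sum_v r u v) * C *
  (d ^+ 2 / N%:R * (d / N%:R) ^+ j))); last by ring.
apply: ler_wpM2r; last lra.
by rewrite !mulr_ge0 ?exprn_ge0 ?divr_ge0.
Qed.
End BulkPair.

Lemma config_weight_xi a : wt (xi N a) = site_weight m d a N.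
Proof.
rewrite /config_weight (bigD1 a)//= occ_xi eqxx mul1n big1 ?mulr1// => z za.
by rewrite occ_xi (negPf za) /site_weight expr0 mul1r.
Qed.

Lemma shared_weight z1 z2 : z1 != z2 ->
  \sum_eta ((N <= #|S| * occ eta z1) && (0 < occ eta z2))%N%:R * wt eta <=
  d / N%:R * (2 * #|S|%:R * 2 ^+ #|S| * (rise d N - 1)).
Proof.
move=> z12.
pose Phi z n : R := site_weight m d z n *
  (if z == z1 then (N <= #|S| * n)%N%:R else 1) *
  (if z == z2 then (0 < n)%N%:R else 1).
have Phi0 z n : 0 <= Phi z n.
  rewrite /Phi; apply: mulr_ge0; last by case: ifP.
  by apply: mulr_ge0; [exact: site_weight_ge0|case: ifP].
have M0 : 0 <= 2 * #|S|%:R * (d / N%:R) by rewrite !mulr_ge0 ?divr_ge0.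
have PhiM n : (n <= N)%N -> Phi z1 n <= 2 * #|S|%:R * (d / N%:R).
  move=> nN; rewrite /Phi eqxx (negPf z12) mulr1.
  have [h|h] := boolP (N <= #|S| * n)%N; last by rewrite mulr0.
  by rewrite mulr1; exact: big_site_weight.
have PhiS z : z != z1 -> \sum_(n < N.+1) Phi z n <=
    2 * (if z == z2 then rise d N - 1 else 1).
  move=> zz1; rewrite /Phi (negPf zz1); have [->|_] := eqVneq z z2.
    rewrite -sum_weight_gt0.
    apply: (@le_trans _ _ (1 * \sum_(n < N.+1) (0 < n)%N%:R * weight d n)).
      rewrite mul1r; apply: ler_sum => n _.
      by rewrite mulr1 mulrC ler_wpM2l// site_weight_le.
    rewrite ler_wpM2r ?ler1n//.
    by apply: sumr_ge0 => n _; rewrite mulr_ge0 ?weight_ge0.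
  rewrite mulr1; under eq_bigr do rewrite !mulr1; exact: sum_site_weight.
have -> : \sum_eta ((N <= #|S| * occ eta z1) && (0 < occ eta z2))%N%:R * wt eta =
    \sum_(eta : config S N) \prod_z Phi z (occ eta z).
  apply: eq_bigr => eta _.
  have -> : \prod_z Phi z (occ eta z) = config_weight m d (occ eta) *
      \prod_z (if z == z1 then (N <= #|S| * occ eta z)%N%:R else 1) *
      \prod_z (if z == z2 then (0 < occ eta z)%N%:R else 1).
    by rewrite -!big_split.
  by rewrite !prod_at -mulrA -natrM mulnb mulrC.
apply: le_trans (sum_config_le Phi0 PhiM) _.
rewrite [leRHS](_ : _ = 2 * #|S|%:R * (d / N%:R) *
  (2 ^+ #|S| * (rise d N - 1))); last by ring.
rewrite ler_wpM2l//.
apply: (@le_trans _ _ (\prod_(z | z != z1)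
    (2 * (if z == z2 then rise d N - 1 else 1)))).
  by apply: ler_prod => z zz1; rewrite PhiS// andbT; apply: sumr_ge0 => n _.
rewrite big_split/= prod_indicator eq_sym (negPf z12) ler_wpM2r//.
  by rewrite subr_ge0 rise_ge1.
by rewrite prodr_const ler_eXn2l ?ltr1n//; exact: max_card.
Qed.

(** Apart from the configurations with all particles at one site, one site
    carries a positive fraction of the particles and another one is not empty,
    which costs [d / N] and [rise d N - 1]. *)
Lemma not_condensed_weight :
  \sum_(eta | [forall x, (x \in Sstar m) ==> (eta != xi N x)]) wt eta <=
  d / N%:R * (#|S|%:R ^+ 2 * (2 * #|S|%:R * 2 ^+ #|S| * (rise d N - 1)) +
              2 * \sum_(a in S0 m) m a ^+ N).
Proof.
have wt0 eta : 0 <= wt eta by exact: config_weight_ge0.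
pose shared z1 z2 eta := ((N <= #|S| * occ eta z1) && (0 < occ eta z2))%N.
have pointwise eta : [forall x, (x \in Sstar m) ==> (eta != xi N x)] ->
    wt eta <= \sum_z1 \sum_z2 ((z1 != z2) && shared z1 z2 eta)%:R * wt eta +
              \sum_(a in S0 m) (eta == xi N a)%:R * wt eta.
  move=> /forallP nstar.
  have sum0 : 0 <= \sum_z1 \sum_z2
      ((z1 != z2) && shared z1 z2 eta)%:R * wt eta.
    by do 2![apply: sumr_ge0 => ? _]; rewrite mulr_ge0.
  have [|z1 _ N1] := @pigeonhole S N xpredT (occ eta) 1 N_gt0.
    by rewrite sum_occ mul1n.
  rewrite mul1n in N1.
  have [/existsP[z2 /andP[z21 z2pos]]|] :=
      boolP [exists z2, (z2 != z1) && (0 < occ eta z2)%N].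
    rewrite (bigD1 z1)//= (bigD1 z2)//= /shared N1 z2pos eq_sym z21 mul1r.
    rewrite -!addrA lerDl !addr_ge0//; do ?[apply: sumr_ge0 => ? _];
      by rewrite mulr_ge0.
  rewrite negb_exists => /forallP alone.
  have etaE : eta = xi N z1.
    have off z : z != z1 -> occ eta z = 0%N.
      by move=> zz1; have := alone z; rewrite zz1 -eqn0Ngt => /eqP.
    apply: occ_inj => z; rewrite occ_xi; have [->|/off ->//] := eqVneq z z1.
    rewrite mul1n -[RHS](sum_occ eta) (bigD1 z1)//= big1 ?addn0//.
  have z1S : z1 \in S0 m.
    rewrite !inE; have := nstar z1; rewrite {1}etaE eqxx implybF.
    by rewrite !inE.
  rewrite -[leLHS]add0r lerD// (bigD1 z1)//= {2}etaE eqxx mul1r lerDl.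
  by apply: sumr_ge0 => ? _; rewrite mulr_ge0.
rewrite big_mkcond/=; apply: (@le_trans _ _ (\sum_eta
   (\sum_z1 \sum_z2 ((z1 != z2) && shared z1 z2 eta)%:R * wt eta +
              \sum_(a in S0 m) (eta == xi N a)%:R * wt eta))).
  apply: ler_sum => eta _; case: ifP => [|_]; first exact: pointwise.
  apply: addr_ge0; first by do 2![apply: sumr_ge0 => ? _]; rewrite mulr_ge0.
  by apply: sumr_ge0 => ? _; rewrite mulr_ge0.
have dN0 : 0 <= d / N%:R by rewrite divr_ge0.
rewrite big_split/= mulrDr lerD//.
  rewrite exchange_big/=; under eq_bigr do rewrite exchange_big/=.
  set B := 2 * _ * _ * _.
  have B0 : 0 <= d / N%:R * B.
    by rewrite mulr_ge0// !mulr_ge0 ?exprn_ge0// subr_ge0 rise_ge1.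
  apply: (@le_trans _ _ (\sum_(z1 : S) \sum_(z2 : S) d / N%:R * B)); last first.
    by rewrite !sumr_const; apply: le_of_eq; ring.
  apply: ler_sum => z1 _; apply: ler_sum => z2 _.
  have [->|z12] := eqVneq z1 z2.
    by rewrite big1// => eta _; rewrite mul0r.
  exact: shared_weight.
rewrite exchange_big/= mulrCA mulr_sumr mulr_sumr; apply: ler_sum => a _.
rewrite (bigD1 (xi N a))//= eqxx mul1r big1 ?addr0 => [|eta /negPf->]; last first.
  by rewrite mul0r.
rewrite config_weight_xi [leRHS](_ : _ = 2 * d * m a ^+ N / N%:R); last by ring.
by rewrite ler_pdivlMr// mulrC natr_site_weight.
Qed.
End UpperBound.

(** * Transition probabilities and exponential smallness *)

Section ChainBounds.
Variables (R : realType) (T : finType) (q : T -> T -> R) (W : T -> R).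
Hypothesis W_ge0 : forall x, 0 <= W x.
Hypothesis q_ge0 : forall x y, 0 <= q x y.
Hypothesis qW : reversible q W.

Lemma sum_transition t x : \sum_y transition q t x y = 1.
Proof.
have <- : semigroup q (fun=> 1) t x = \sum_y transition q t x y.
  by rewrite semigroup_transition; apply: eq_bigr => y _; rewrite mul1r.
have L1 k z : iter k.+1 (generator q) (fun=> 1) z = 0.
  elim: k z => [|k IHk] z; rewrite iterS /generator big1// => y _.
    by rewrite subrr mulr0.
  by rewrite !IHk subrr mulr0.
apply/cvg_lim => //; rewrite -(cvg_shiftn 1).
rewrite (_ : (fun n => _) = cst 1); first exact: cvg_cst.
apply/funext => n; rewrite /series/= addn1 big_nat_recl//= /exp_coeff/=.
rewrite expr0 fact0 divr1 mul1r big1 ?addr0// => i _.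
by rewrite -iterS L1 mulr0.
Qed.

(** Detailed balance for the semigroup, with one of the two transition
    probabilities bounded by [1]. *)
Lemma transition_out (A : pred T) t x : 0 < W x ->
  (forall y z, 0 <= transition q t y z) ->
  \sum_(y | ~~ A y) transition q t x y <= (\sum_(y | ~~ A y) W y) / W x.
Proof.
move=> Wx p0; rewrite ler_pdivlMr// mulrC mulr_sumr; apply: ler_sum => y _.
rewrite (transition_sym qW) ler_piMr//.
rewrite -(sum_transition t y) (bigD1 x)//= lerDl.
by apply: sumr_ge0 => z _.
Qed.

(** [semigroup_energy] applied to the indicator of [z]. *)
Lemma transition_merge c t x y z : 0 < t ->
  (forall h : T -> R, (h x - h y) ^+ 2 <= c * energy q W h h) -> 0 <= c ->
  (transition q t x z - transition q t y z) ^+ 2 <= c * W z / t.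
Proof.
move=> t0 hxy c0; pose g w : R := (w == z)%:R.
have -> : transition q t x z - transition q t y z =
  semigroup q g t x - semigroup q g t y by [].
apply: le_trans (hxy _) _; rewrite -mulrA ler_wpM2l// ler_pdivlMr// mulrC.
have gW : inner W g g = W z.
  rewrite /inner (bigD1 z)//= /g eqxx !mulr1 big1 ?addr0// => w /negPf->.
  by rewrite mul0r mulr0.
rewrite -gW (le_trans _ (semigroup_energy W_ge0 qW g (ltW t0)))//.
rewrite ler_wpM2r ?energy_ge0//; have := t0; lra.
Qed.

(** [semigroup_dist] at the starting point, where [f] takes its maximum [1]: the
    expectation of [f] at time [t] stays close to [1]. *)
Lemma transition_escape (A : pred T) f t x : 0 <= t -> 0 < W x ->
  (forall y, 0 <= f y <= 1) -> f x = 1 ->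
  (forall y z, 0 <= transition q t y z) ->
  1 - \sum_(y | A y) f y * transition q t x y -
    \sum_(y | ~~ A y) transition q t x y <= Num.sqrt (t * energy q W f f / W x).
Proof.
move=> t0 Wx f01 fx p0; set e := 1 - _ - _.
have [ele0|e0] := leP e 0; first exact: le_trans ele0 (sqrtr_ge0 _).
rewrite -(ger0_norm (ltW e0)) -sqrtr_sqr ler_wsqrtr//.
have ePf : 0 <= e <= f x - semigroup q f t x.
  rewrite (ltW e0)/= fx /e -addrA -opprD lerD2l lerN2 semigroup_transition.
  rewrite (bigID A)/= lerD2l; apply: ler_sum => y _.
  by rewrite ler_piMl//; case/andP: (f01 y).
rewrite ler_pdivlMr//; apply: le_trans (semigroup_dist W_ge0 q_ge0 qW f t0).
rewrite /inner (bigD1 x)//= mulrC -[leLHS]addr0 lerD//.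
  by rewrite ler_wpM2l// expr2; case/andP: ePf => ? ?; rewrite ler_pM.
by apply: sumr_ge0 => y _; rewrite mulr_ge0// -expr2 sqr_ge0.
Qed.

End ChainBounds.

Lemma is_markov_chain_transition (R : realType) (T : finType) (q : T -> T -> R)
    (disp : measure_display) (Om : measurableType disp)
    (P : T -> probability Om R) (X : R -> Om -> T) t x y :
  is_markov_chain q P X -> 0 <= t ->
  P x [set w | X t w = y] = (transition q t x y)%:E.
Proof.
move=> mc t0; have := mc_fdd mc x (s := [:: (t, y)]).
rewrite /= t0 subr0 mulr1 => /(_ isT) <-; congr (P x _).
apply/seteqP; split=> w /= Xw.
  by move=> u; rewrite inE => /eqP ->.
by have := Xw (t, y); rewrite inE eqxx => /(_ isT).
Qed.

Lemma cvg0_of_sqr (R : realType) (u v : nat -> R) :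
  (\forall N \near \oo, u N ^+ 2 <= v N) -> v N @[N --> \oo] --> 0 ->
  u N @[N --> \oo] --> 0.
Proof.
move=> uv /cvgrPdist_lt v0; apply/cvgrPdist_lt => e e0.
have e2 : 0 < e ^+ 2 by rewrite exprn_gt0.
apply: filterS2 uv (v0 _ e2) => N uvN; rewrite !sub0r !normrN => vN.
rewrite -(ltr_pXn2r (_ : 0 < 2)%N) ?nnegrE ?(ltW e0)//.
rewrite real_normK ?num_real// (le_lt_trans uvN)//.
exact: le_lt_trans (ler_norm _) vN.
Qed.

(** Powers of the number of particles are beaten by the exponentially small
    stationary weight of a site outside [Sstar], uniformly enough to absorb
    the negative powers of [d] as well. *)
Lemma S0_negligible_near (R : realType) (d : nat -> R) (s k : nat) (mz : R) :
  (forall eps : R, 0 < eps -> d N * expR (eps * N%:R) @[N --> \oo] --> +oo) ->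
  0 <= mz < 1 -> (0 < k)%N ->
  \forall N \near \oo, forall n, (N <= k * n)%N ->
    N.+1%:R ^+ s * (2 * N%:R ^+ 3) * mz ^+ n <= d N ^+ 4.
Proof.
move=> d_exp /andP[mz0 mz1] k0.
have k0' : 0 < k%:R :> R by rewrite ltr0n.
pose c := (1 - mz) / k%:R; have c0 : 0 < c by rewrite divr_gt0// subr_gt0.
pose K := (s + 4)%N; pose b := c / (2 * K%:R).
have K0 : 0 < K%:R :> R by rewrite ltr0n /K addn4.
have b0 : 0 < b by rewrite divr_gt0// mulr_gt0.
have eps0 : 0 < c / 8 by rewrite divr_gt0.
have : \forall N \near \oo, 1 <= d N * expR (c / 8 * N%:R).
  by apply: cvgry_ge; exact: d_exp.
have : \forall N \near \oo, 2 ^+ (s + 1) / b ^+ K <= N%:R :> R.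
  by apply: cvgry_ge; exact: cvgr_idn.
apply: filterS3 (nbhs_infty_ge 1) => N N1 Nbig dbig n Nn.
have N0 : 0 < N%:R :> R by rewrite ltr0n.
set E := expR (c / 2 * N%:R).
have E0 : 0 < E by exact: expR_gt0.
have mE : mz ^+ n <= E^-1 * E^-1.
  apply: (@le_trans _ _ (expR (- c * N%:R))).
    apply: (@le_trans _ _ (expR (- (1 - mz)) ^+ n)).
      apply: lerXn2r; rewrite ?nnegrE ?expR_ge0//.
      by have := expR_ge1Dx (- (1 - mz)); lra.
    rewrite -expRM_natr ler_expR mulNr mulNr lerN2 /c mulrAC ler_pdivrMr//.
    by rewrite -mulrA ler_wpM2l ?subr_ge0 ?(ltW mz1)// -natrM ler_nat mulnC.
  rewrite /E -!expRN -expRD ler_expR; lra.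
have dE : E^-1 <= d N ^+ 4.
  have -> : E^-1 = expR (- (c / 8 * N%:R)) ^+ 4.
    by rewrite /E -expRM_natr -expRN; congr expR; field.
  apply: lerXn2r; rewrite ?nnegrE ?expR_ge0//.
    rewrite -(pmulr_lge0 _ (expR_gt0 (c / 8 * N%:R))).
    by rewrite (le_trans _ dbig).
  by rewrite expRN -[leLHS]mul1r ler_pdivrMr ?expR_gt0.
have pE : N.+1%:R ^+ s * (2 * N%:R ^+ 3) <= E.
  have EK : (b * N%:R) ^+ K <= E.
    have -> : E = expR (b * N%:R) ^+ K.
      by rewrite /E -expRM_natr; congr expR; rewrite /b; field; rewrite gt_eqF.
    have bN0 : 0 <= b * N%:R by rewrite mulr_ge0// ltW.
    apply: lerXn2r; rewrite ?nnegrE ?expR_ge0//.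
    by have := expR_ge1Dx (b * N%:R); lra.
  apply: le_trans EK; rewrite exprMn.
  apply: (@le_trans _ _ ((2 * N%:R) ^+ s * (2 * N%:R ^+ 3))).
    rewrite ler_wpM2r ?mulr_ge0 ?exprn_ge0//.
    by apply: lerXn2r; rewrite ?nnegrE// -natrM ler_nat leqS_double.
  rewrite [leLHS](_ : _ = 2 ^+ (s + 1) * N%:R ^+ (s + 3)); last first.
    rewrite exprMn !exprD expr1; move: (2 ^+ s) (N%:R ^+ s) => p t; ring.
  have -> : N%:R ^+ K = N%:R * N%:R ^+ (s + 3) :> R.
    by rewrite -exprS /K addn4 addn3.
  rewrite mulrA ler_wpM2r ?exprn_ge0//.
  by rewrite mulrC -ler_pdivrMr ?exprn_gt0.
apply: le_trans dE; have -> : E^-1 = E * (E^-1 * E^-1) by rewrite mulVKf ?gt_eqF.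
by apply: ler_pM => //; rewrite ?mulr_ge0 ?exprn_ge0.
Qed.

(** * Condensates on the three time scales *)

Section Metastability.
Variables (R : realType) (S : finType) (r : S -> S -> R) (m : S -> R).
Hypothesis r_ge0 : forall x y, 0 <= r x y.
Hypothesis r_irr : irreducible r.
Hypothesis m_ge0 : forall x, 0 <= m x.
Hypothesis m_rev : reversible r m.
Hypothesis m_le1 : forall x, m x <= 1.
Hypothesis m_max : exists x, m x = 1.
Variables (d alpha : nat -> R).
Hypothesis d_gt0 : forall N, (0 < N)%N -> 0 < d N.
Hypothesis d_log : d N * ln N%:R @[N --> \oo] --> 0.
Hypothesis d_exp : forall eps : R, 0 < eps ->
  d N * expR (eps * N%:R) @[N --> \oo] --> +oo.
Hypothesis alpha_gt0 : forall N, (0 < N)%N -> 0 < alpha N.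
Notation rate N := (inclusion_rate r (d N) (N := N)).
Notation wt N := (fun eta : config S N => config_weight m (d N) (occ eta)).
Hypothesis transition_ge0 : forall N (eta zeta : config S N), (0 < N)%N ->
  0 <= transition (rate N) (alpha N) eta zeta.
Implicit Types (x y z a u v : S) (N : nat).

Definition timescale j N : R := N%:R ^+ j / d N ^+ j.+1.

Definition condensate_prob N x y : R :=
  transition (rate N) (alpha N) (xi N x) (xi N y).

Lemma S0E z : (z \in S0 m) = (m z < 1).
Proof. by rewrite !inE lt_neqAle m_le1 andbT. Qed.

Lemma d_cvg0 : d N @[N --> \oo] --> 0.
Proof.
apply: (squeeze_cvgr _ (cvg_cst _) d_log).
have : \forall N \near \oo, expR 1 <= N%:R :> R.
  by apply: cvgry_ge; exact: cvgr_idn.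
apply: filterS2 (nbhs_infty_ge 1) => N N1 eN; have dN := d_gt0 N1.
rewrite (ltW dN) ler_peMr ?(ltW dN)// -[leLHS]expRK ler_ln ?posrE ?expR_gt0//.
by rewrite ltr0n.
Qed.

Definition geometric_bound : R := 1 + \sum_(z in S0 m) (1 - m z)^-1.

Lemma geometric_bound_ge1 : 1 <= geometric_bound.
Proof.
rewrite lerDl; apply: sumr_ge0 => z; rewrite S0E => mz.
by rewrite invr_ge0 subr_ge0 ltW.
Qed.

Lemma sum_geometric z N : z \in S0 m ->
  \sum_(n < N.+1) m z ^+ n <= geometric_bound.
Proof.
move=> zS; have := zS; rewrite S0E => mz.
have mz0 : 0 < 1 - m z by rewrite subr_gt0.
apply: (@le_trans _ _ (1 - m z)^-1).
  rewrite -[leRHS]mul1r ler_pdivlMr//.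
  rewrite [leLHS](_ : _ = 1 - m z ^+ N.+1); first by rewrite gerBl exprn_ge0.
  by rewrite -[RHS]opprB subrX1 -mulNr opprB mulrC.
rewrite /geometric_bound (bigD1 z)//= addrCA lerDl addr_ge0//.
apply: sumr_ge0 => t /andP[]; rewrite S0E => mt _.
by rewrite invr_ge0 subr_ge0 ltW.
Qed.

Let K := (4 * #|S|)%N.

Lemma near_regime : \forall N \near \oo,
  [/\ (12 <= N)%N, d N <= 1, rise (d N) N <= 2 &
   forall z n, z \in S0 m -> (N <= K * n)%N ->
     N.+1%:R ^+ #|S| * (2 * N%:R ^+ 3) * m z ^+ n <= d N ^+ 4].
Proof.
have S_gt0 : (0 < #|S|)%N.
  by case: m_max => x _; apply/card_gt0P; exists x.
have neg : \forall N \near \oo, forall z, z \in S0 m -> forall n,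
    (N <= K * n)%N -> N.+1%:R ^+ #|S| * (2 * N%:R ^+ 3) * m z ^+ n <= d N ^+ 4.
  apply: filter_forall => z; have [zS|zS] := boolP (z \in S0 m).
    apply: filterS (S0_negligible_near #|S| d_exp (mz := m z) (k := K) _ _).
    - by move=> N h _ n; exact: h.
    - by rewrite m_ge0 -S0E.
    - by rewrite muln_gt0.
  by exists 0%N.
have rise1 := rise_cvg d_gt0 d_log d_cvg0.
have r2 : \forall N \near \oo, rise (d N) N <= 2.
  by apply: (cvgr_le _ rise1); rewrite ltr1n.
have d1 : \forall N \near \oo, d N <= 1.
  by apply: (cvgr_le _ d_cvg0).
apply: filterS3 (filterI (nbhs_infty_ge 12) d1) r2 neg => N [N12 dN1] rN nN.
by split=> // z n zS; exact: nN.
Qed.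

(** All condensates on [Sstar] have the same weight. *)
Lemma condensate_prob_sym N x y : (0 < N)%N -> x \in Sstar m -> y \in Sstar m ->
  condensate_prob N x y = condensate_prob N y x.
Proof.
move=> N0; rewrite !inE => /eqP mx /eqP my.
have := transition_sym (inclusion_reversible (d N) (N := N) m_rev) (alpha N)
  (xi N x) (xi N y).
rewrite !config_weight_xi /site_weight mx my => /mulfI; apply.
rewrite expr1n mul1r gt_eqF//.
case: N N0 => // N _; rewrite /weight mulr_gt0 ?divr_gt0 ?d_gt0//.
by rewrite rise_gt0// ltW// d_gt0.
Qed.

Definition not_condensed N (eta : config S N) : bool :=
  [forall x, (x \in Sstar m) ==> (eta != xi N x)].

(** Bound for the weight of the non-condensed configurations relative to that of
    a condensate. *)
Definition not_condensed_bound N : R :=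
  #|S|%:R ^+ 2 * (2 * #|S|%:R * 2 ^+ #|S| * (rise (d N) N - 1)) +
  2 * \sum_(a in S0 m) m a ^+ N.

Lemma not_condensed_bound_cvg0 : not_condensed_bound N @[N --> \oo] --> 0.
Proof.
have rise1 := rise_cvg d_gt0 d_log d_cvg0.
have m0 : \sum_(a in S0 m) m a ^+ N @[N --> \oo] --> \sum_(a in S0 m) (0 : R).
  apply: cvg_big; first exact: add_continuous.
  move=> a; rewrite S0E => ma; apply: cvg_expr.
  by rewrite ger0_norm.
rewrite big1 in m0 => [|//].
rewrite -[X in _ --> X](_ : #|S|%:R ^+ 2 * (2 * #|S|%:R * 2 ^+ #|S| * (1 - 1)) +
  2 * 0 = 0); last by rewrite subrr !mulr0 addr0.
apply: cvgD; last by apply: cvgM; [exact: cvg_cst|exact: m0].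
apply: cvgM; first exact: cvg_cst.
apply: cvgM; first exact: cvg_cst.
by apply: cvgB => //; exact: cvg_cst.
Qed.

Lemma config_weight_star N x : x \in Sstar m -> (0 < N)%N -> d N <= 1 ->
  rise (d N) N <= 2 ->
  d N / N%:R <= wt N (xi N x) <= 2 * (d N / N%:R).
Proof.
rewrite inE => /eqP mx N0 d1 r2; rewrite config_weight_xi.
have dN := d_gt0 N0; have N0' : 0 < N%:R :> R by rewrite ltr0n.
apply/andP; split.
  by rewrite /site_weight mx expr1n mul1r (weight_ge (ltW dN) d1).
rewrite mulrA ler_pdivlMr// mulrC.
by rewrite (le_trans (natr_site_weight m_ge0 dN r2 _ (leqnn N)))// mx expr1n mulr1.
Qed.

Lemma not_condensed_prob N x : x \in Sstar m -> (0 < N)%N -> d N <= 1 ->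
  rise (d N) N <= 2 ->
  \sum_(eta | ~~ ~~ not_condensed eta) transition (rate N) (alpha N) (xi N x) eta
    <= not_condensed_bound N.
Proof.
move=> xS N0 d1 r2; have dN := d_gt0 N0.
have N0' : 0 < N%:R :> R by rewrite ltr0n.
have dN0 : 0 < d N / N%:R by rewrite divr_gt0.
have /andP[Wlo _] := config_weight_star xS N0 d1 r2.
have Wx := lt_le_trans dN0 Wlo.
have W0 eta : 0 <= wt N eta by apply: config_weight_ge0 => //; exact: ltW.
have := transition_out W0 (inclusion_reversible (d N) (N := N) m_rev)
  (fun eta => ~~ not_condensed eta) Wx (fun eta zeta => transition_ge0 eta zeta N0).
move=> /le_trans; apply; rewrite ler_pdivrMr//.
under eq_bigl do rewrite negbK.
apply: le_trans (not_condensed_weight m_ge0 m_le1 dN N0 r2) _.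
rewrite -/(not_condensed_bound N) mulrC ler_wpM2l//.
rewrite addr_ge0//.
  rewrite mulr_ge0 ?exprn_ge0// mulr_ge0 ?exprn_ge0 ?mulr_ge0//.
  by rewrite subr_ge0 rise_ge1// ltW.
by rewrite mulr_ge0// sumr_ge0// => a _; rewrite exprn_ge0.
Qed.

Lemma sum_condensed N (F : config S N -> R) : (0 < N)%N ->
  \sum_(eta | ~~ not_condensed eta) F eta = \sum_(x in Sstar m) F (xi N x).
Proof.
move=> N0; have xi_inj : injective (@xi S N).
  move=> a b /(congr1 (fun eta => occ eta a)); rewrite !occ_xi eqxx mul1n.
  by case: eqP => // _; rewrite mul0n => N0E; rewrite N0E in N0.
rewrite -(big_imset F (h := @xi S N) (A := Sstar m)); last first.
  by move=> ? ? _ _; exact: xi_inj.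
apply: eq_bigl => eta; rewrite /not_condensed negb_forall; apply/existsP/imsetP.
  by move=> [x]; rewrite negb_imply negbK => /andP[xS /eqP ->]; exists x.
by move=> [x xS ->]; exists x; rewrite negb_imply negbK xS eqxx.
Qed.

Lemma sum_star_bounds N x : x \in Sstar m -> (0 < N)%N -> d N <= 1 ->
  rise (d N) N <= 2 ->
  1 - not_condensed_bound N <= \sum_(y in Sstar m) condensate_prob N x y <= 1.
Proof.
move=> xS N0 d1 r2; have out := not_condensed_prob xS N0 d1 r2.
have := sum_transition (rate N) (alpha N) (xi N x).
rewrite (bigID (fun eta => ~~ not_condensed eta))/= sum_condensed// => E.
have out0 : 0 <= \sum_(eta | ~~ ~~ not_condensed eta)
    transition (rate N) (alpha N) (xi N x) eta.
  by apply: sumr_ge0 => eta _; exact: transition_ge0.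
by rewrite /condensate_prob; apply/andP; split; lra.
Qed.

Lemma sum_star_cvg x : x \in Sstar m ->
  \sum_(y in Sstar m) condensate_prob N x y @[N --> \oo] --> (1 : R).
Proof.
move=> xS; have lo : 1 - not_condensed_bound N @[N --> \oo] --> (1 : R).
  rewrite -[X in _ --> X]subr0; apply: cvgB; first exact: cvg_cst.
  exact: not_condensed_bound_cvg0.
apply: (squeeze_cvgr _ lo (cvg_cst _)).
apply: filterS near_regime => N [N12 d1 r2 _].
by apply: sum_star_bounds => //; exact: leq_trans N12.
Qed.

(** By [transition_escape] the expectation of [cutoff V] stays close to [1] as
    long as time times energy is small compared with the weight of a condensate;
    on condensates [cutoff V] is the indicator of [V], and the other
    configurations carry no mass in the limit. *)
Lemma no_escape (V : {set S}) j x : x \in Sstar m -> x \in V ->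
  (forall u v, 0 < r u v -> (u \in V) != (v \in V) ->
     (j <= (u \in S0 m) + (v \in S0 m))%N) ->
  alpha N / timescale j N @[N --> \oo] --> 0 ->
  \sum_(y in Sstar m | y \in V) condensate_prob N x y @[N --> \oo] --> (1 : R).
Proof.
move=> xS xV cross alpha0.
pose C : R := 5 * (\sum_u \sum_v r u v) *
  (#|S|%:R ^+ 2 * pair_const S geometric_bound K + 1).
have lo : 1 - (Num.sqrt (C * (alpha N / timescale j N)) + not_condensed_bound N)
    @[N --> \oo] --> (1 : R).
  rewrite -[X in _ --> X]subr0; apply: cvgB; first exact: cvg_cst.
  rewrite -[X in _ --> X]addr0; apply: cvgD; last exact: not_condensed_bound_cvg0.
  have -> : 0 = Num.sqrt (C * 0) :> R by rewrite mulr0 sqrtr0.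
  apply: continuous_cvg; first exact: sqrt_continuous.
  by apply: cvgM => //; exact: cvg_cst.
apply: (squeeze_cvgr _ lo (cvg_cst _)).
apply: filterS near_regime => N [N12 d1 r2 neg].
have N0 : (0 < N)%N by exact: leq_trans N12.
have dN := d_gt0 N0; have aN := alpha_gt0 N0.
have N0' : 0 < N%:R :> R by rewrite ltr0n.
have dN0 : 0 < d N / N%:R by rewrite divr_gt0.
have /andP[_ star1] := sum_star_bounds xS N0 d1 r2.
apply/andP; split; last first.
  rewrite (le_trans _ star1)// [leRHS](bigID (mem V))/= lerDl.
  by apply: sumr_ge0 => y _; exact: transition_ge0.
have /andP[Wlo _] := config_weight_star xS N0 d1 r2.
have Wx := lt_le_trans dN0 Wlo.
have W0 eta : 0 <= wt N eta by apply: config_weight_ge0 => //; exact: ltW.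
have q0 := inclusion_rate_ge0 r_ge0 (ltW dN) (N := N).
have S_gt0 : (0 < #|S|)%N by apply/card_gt0P; exists x.
have K0 : (0 < K)%N by rewrite muln_gt0.
have energyV := energy_cutoff r_ge0 m_ge0 m_le1 dN d1 N0 r2 geometric_bound_ge1
  (@sum_geometric ^~ N) K0 neg erefl N12 cross.
have f01 (eta : config S N) : 0 <= cutoff R V eta <= 1.
  by rewrite cutoff_ge0 cutoff_le1.
have fx : cutoff R V (xi N x) = 1 by rewrite cutoff_xi// xV.
have := transition_escape W0 q0 (inclusion_reversible (d N) (N := N) m_rev)
  (fun eta => ~~ not_condensed eta) (ltW aN) Wx f01 fx
  (fun eta zeta => transition_ge0 eta zeta N0).
rewrite sum_condensed//.
have -> : \sum_(y in Sstar m) cutoff R V (xi N y) *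
    transition (rate N) (alpha N) (xi N x) (xi N y) =
    \sum_(y in Sstar m | y \in V) condensate_prob N x y.
  rewrite [RHS]big_mkcondr; apply: eq_bigr => y _; rewrite cutoff_xi//.
  by case: (y \in V); rewrite ?mul1r ?mul0r.
have out := not_condensed_prob xS N0 d1 r2.
have sq : alpha N * energy (rate N) (wt N) (cutoff R V) (cutoff R V) /
    wt N (xi N x) <= C * (alpha N / timescale j N).
  rewrite ler_pdivrMr//.
  have T0 : 0 <= C * (alpha N / timescale j N).
    rewrite mulr_ge0 ?divr_ge0 ?exprn_ge0 ?(ltW dN) ?(ltW aN)//.
    have Q0 : 0 <= geometric_bound by exact: le_trans geometric_bound_ge1.
    rewrite /C !mulr_ge0//; first by do 2![apply: sumr_ge0 => ? _].
    by rewrite addr_ge0// mulr_ge0 ?exprn_ge0// !mulr_ge0 ?exprn_ge0.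
  apply: le_trans (ler_wpM2l T0 Wlo).
  apply: le_trans (ler_wpM2l (ltW aN) energyV) _.
  rewrite -/C /timescale expr_div_n [d N ^+ j.+1]exprS; apply: le_of_eq.
  have Nj : N%:R ^+ j != 0 :> R by rewrite expf_neq0 ?gt_eqF.
  have dj : d N ^+ j != 0 by rewrite expf_neq0 ?gt_eqF.
  move: (N%:R ^+ j) (d N ^+ j) Nj dj => Nj dj Nj0 dj0.
  by field; rewrite Nj0 dj0 !gt_eqF.
have := ler_wsqrtr sq; lra.
Qed.

(** Two sites whose resistance is of order [timescale j] have become
    indistinguishable as starting points on larger time scales. *)
Lemma line_close_merges (x y z : S) j : x != y -> z \in Sstar m ->
  line_close r m x y j x y ->
  timescale j N / alpha N @[N --> \oo] --> 0 ->
  condensate_prob N x z - condensate_prob N y z @[N --> \oo] --> 0.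
Proof.
move=> xy zS /(close_xi xy)[C C0 CE] scale0.
apply: (@cvg0_of_sqr R _ (fun N => 2 * C * (timescale j N / alpha N))).
  apply: filterS near_regime => N [N12 d1 r2 _].
  have N0 : (0 < N)%N by exact: leq_trans N12.
  have dN := d_gt0 N0; have aN := alpha_gt0 N0.
  have N0' : 0 < N%:R :> R by rewrite ltr0n.
  have W0 eta : 0 <= wt N eta by apply: config_weight_ge0 => //; exact: ltW.
  have q0 := inclusion_rate_ge0 r_ge0 (ltW dN) (N := N).
  have /andP[_ Whi] := config_weight_star zS N0 d1 r2.
  have c0 : 0 <= C * (N%:R / (d N ^+ 2 * (d N / N%:R) ^+ j)).
    by rewrite mulr_ge0// divr_ge0// mulr_ge0 ?exprn_ge0 ?divr_ge0 ?(ltW dN).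
  have := transition_merge W0 q0 (inclusion_reversible (d N) (N := N) m_rev)
    (xi N z) aN (fun h => CE (d N) N h dN d1 N0) c0.
  move=> /le_trans; apply.
  rewrite ler_pdivrMr//; apply: le_trans (ler_wpM2l c0 Whi) _.
  rewrite /timescale expr_div_n [d N ^+ j.+1]exprS; apply: le_of_eq.
  have Nj : N%:R ^+ j != 0 :> R by rewrite expf_neq0 ?gt_eqF.
  have dj : d N ^+ j != 0 by rewrite expf_neq0 ?gt_eqF.
  move: (N%:R ^+ j) (d N ^+ j) Nj dj => Nj dj Nj0 dj0.
  by field; rewrite Nj0 dj0 !gt_eqF.
rewrite -[X in _ --> X](mulr0 (2 * C)); apply: cvgM => //; exact: cvg_cst.
Qed.

(** A row is asymptotically constant on [D], because the columns are and the
    matrix is symmetric, and its sum tends to [1]. *)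
Lemma equidistributed (D : {set S}) x : {subset D <= Sstar m} -> x \in D ->
  (forall y z w, y \in D -> z \in D -> w \in Sstar m ->
     condensate_prob N y w - condensate_prob N z w @[N --> \oo] --> 0) ->
  \sum_(y in D) condensate_prob N x y @[N --> \oo] --> (1 : R) ->
  forall y, y \in D -> condensate_prob N x y @[N --> \oo] --> (#|D|%:R^-1 : R).
Proof.
move=> DS xD mergeD sum1 y yD.
have cardD : #|D|%:R != 0 :> R.
  by rewrite pnatr_eq0 -lt0n; apply/card_gt0P; exists x.
have column z : z \in D ->
    condensate_prob N x z - condensate_prob N x y @[N --> \oo] --> 0.
  move=> zD; have := mergeD z y x zD yD (DS x xD).
  apply: cvg_trans; apply: near_eq_cvg.
  exists 1%N => // N N1; congr (_ - _).
    by rewrite (condensate_prob_sym N1 (DS x xD) (DS z zD)).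
  by rewrite (condensate_prob_sym N1 (DS x xD) (DS y yD)).
have columns : \sum_(z in D) (condensate_prob N x z - condensate_prob N x y)
    @[N --> \oo] --> \sum_(z in D) (0 : R).
  by apply: cvg_big => [|z zD]; [exact: add_continuous|exact: column].
rewrite big1 in columns => [|//].
have -> : condensate_prob ^~ x ^~ y = fun N => #|D|%:R^-1 *
    (\sum_(z in D) condensate_prob N x z -
     \sum_(z in D) (condensate_prob N x z - condensate_prob N x y)).
  apply/funext => N; rewrite sumrB opprB addrC subrK sumr_const.
  by rewrite -[condensate_prob N x y *+ _]mulr_natl mulKf.
rewrite -[X in _ --> X]mulr1 -[X in _ * X]subr0; apply: cvgM.
  exact: cvg_cst.
exact: cvgB.
Qed.

(** Starting from [xi x] or from [xi y] makes no difference in the limit; being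
    an equivalence relation, this propagates along paths of sites and of
    blocks. *)
Definition merges x y : Prop := forall w, w \in Sstar m ->
  condensate_prob N x w - condensate_prob N y w @[N --> \oo] --> 0.

Lemma merges_refl x : merges x x.
Proof.
move=> w _; rewrite (_ : (fun N => _) = cst 0); first exact: cvg_cst.
by apply/funext => N; rewrite subrr.
Qed.

Lemma merges_sym x y : merges x y -> merges y x.
Proof.
move=> xy w wS; rewrite -[X in _ --> X]oppr0.
rewrite (_ : (fun N => _) =
  fun N => - (condensate_prob N x w - condensate_prob N y w)).
  by apply: cvgN; exact: xy.
by apply/funext => N; rewrite opprB.
Qed.

Lemma merges_trans y x z : merges x y -> merges y z -> merges x z.
Proof.
move=> xy yz w wS; rewrite -[X in _ --> X]addr0.
rewrite (_ : (fun N => _) = fun N =>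
  (condensate_prob N x w - condensate_prob N y w) +
  (condensate_prob N y w - condensate_prob N z w)).
  by apply: cvgD; [exact: xy|exact: yz].
by apply/funext => N; rewrite addrA subrK.
Qed.

Lemma connect_merges (e : rel S) x y :
  (forall u v, e u v -> merges u v) -> connect e x y -> merges x y.
Proof.
move=> em /connectP[p + ->]; elim: p x => [|v p IHp] x /=.
  by move=> _; exact: merges_refl.
by move=> /andP[/em xv /IHp]; exact: merges_trans.
Qed.

Lemma componentsP (T : finType) (V : {set T}) (e : rel T) (A : {set T}) :
  reflect (exists2 x, x \in V &
    A = [set y in V | connect [rel u v | [&& u \in V, v \in V & e u v]] x y]%SET)
  (A \in components V e).
Proof. exact: imsetP. Qed.

Lemma comps2_sub A : A \in comps2 r m -> {subset A <= Sstar m}.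
Proof.
by move=> /componentsP[x0 _ ->] y; rewrite finset.in_set => /andP[].
Qed.

Lemma comps2_closed A u v : A \in comps2 r m -> u \in A -> v \in Sstar m ->
  0 < r u v -> v \in A.
Proof.
move=> /componentsP[x0 _ ->]; rewrite !finset.in_set => /andP[uS cu] vS ruv.
rewrite vS; apply: connect_trans cu (connect1 _).
by rewrite /= !inE uS vS.
Qed.

Lemma comps2_merges A y z : timescale 0 N / alpha N @[N --> \oo] --> 0 ->
  A \in comps2 r m -> y \in A -> z \in A -> merges y z.
Proof.
move=> scale0 /componentsP[x0 _ ->]; rewrite !finset.in_set.
move=> /andP[_ cy] /andP[_ cz].
have em u v : [&& u \in Sstar m, v \in Sstar m & 0 < r u v] -> merges u v.
  move=> /and3P[uS vS ruv]; have [->|uv] := eqVneq u v.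
    exact: merges_refl.
  move=> w wS; apply: (line_close_merges uv wS _ scale0).
  apply: close_neighbour => //.
    by apply/eqP; rewrite inE in uS.
  by apply/eqP; rewrite inE in vS.
exact: merges_trans (merges_sym (connect_merges em cy)) (connect_merges em cz).
Qed.

Lemma comps3P B : B \in comps3 r m -> exists2 A0, A0 \in comps2 r m &
  forall y, y \in B <-> exists2 A, A \in comps2 r m /\
      connect [rel A A' | [&& A \in comps2 r m, A' \in comps2 r m &
                            adj2 r m A A']] A0 A & y \in A.
Proof.
move=> /imsetP[C /componentsP[A0 A0c ->] ->]; exists A0 => // y.
split=> [/finset.bigcupP[A]|[A [Ac cA] yA]].
  by rewrite finset.in_set => /andP[Ac cA] yA; exists A.
by apply/finset.bigcupP; exists A => //; rewrite finset.in_set Ac.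
Qed.

Lemma comps3_sub B : B \in comps3 r m -> {subset B <= Sstar m}.
Proof.
by move=> /comps3P[A0 _ BE] y /BE[A [Ac _]]; exact: comps2_sub.
Qed.

Lemma comps3_closed B u v : B \in comps3 r m -> u \in B -> v \in Sstar m ->
  0 < r u v -> v \in B.
Proof.
move=> /comps3P[A0 _ BE] /BE[A [Ac cA] uA] vS ruv; apply/BE.
by exists A => //; exact: comps2_closed ruv.
Qed.

(** Two blocks of [comps2] with a common neighbour in [S0] are adjacent for
    [adj2]. *)
Lemma comps3_closed2 B u v a : B \in comps3 r m -> u \in B -> v \in Sstar m ->
  a \in S0 m -> 0 < r u a -> 0 < r v a -> v \in B.
Proof.
move=> /comps3P[A0 _ BE] /BE[A [Ac cA] uA] vS aS rua rva; apply/BE.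
pose A' : {set S} := [set y in Sstar m | connect [rel x y |
  [&& x \in Sstar m, y \in Sstar m & [rel x y | 0 < r x y] x y]] v y]%SET.
have A'c : A' \in comps2 r m by apply/componentsP; exists v.
have vA' : v \in A' by rewrite finset.in_set vS connect0.
have [AA'|AA'] := eqVneq A A'; first by exists A => //; rewrite AA'.
exists A' => //; split=> //; apply: connect_trans cA (connect1 _).
rewrite /= Ac A'c /adj2 /= AA' /=; apply/exists_inP; exists u => //.
apply/exists_inP; exists v => //; apply/exists_inP; exists a => //.
by rewrite rua.
Qed.

Lemma comps3_merges B y z : timescale 0 N / alpha N @[N --> \oo] --> 0 ->
  timescale 1 N / alpha N @[N --> \oo] --> 0 ->
  B \in comps3 r m -> y \in B -> z \in B -> merges y z.
Proof.
move=> scale0 scale1 /comps3P[A0 A0c BE].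
have [w0 w0A0] : exists w, w \in A0.
  move: A0c => /componentsP[x0 x0S ->]; exists x0.
  by rewrite finset.in_set x0S connect0.
suff from0 w : w \in B -> merges w0 w.
  by move=> /from0 ? /from0; apply: merges_trans; exact: merges_sym.
move=> /BE[A [Ac /connectP[p + AE] wA]] {BE}.
elim: p A0 A0c w0 w0A0 AE => [|A1 p IHp] A0 A0c w0 w0A0 AE /=.
  by move=> _; apply: (comps2_merges scale0 A0c) => //; rewrite -[A0]AE.
move=> /andP[/and3P[_ A1c /andP[_ adj]] pA1].
move/exists_inP: adj => [u uA0 /exists_inP[v vA1]].
move=> /exists_inP[a aS /andP[rua rva]].
apply: merges_trans (comps2_merges scale0 A0c w0A0 uA0) _.
apply: merges_trans (IHp A1 A1c v vA1 AE pA1).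
have [->|uv] := eqVneq u v; first exact: merges_refl.
have := comps2_sub A0c uA0; have := comps2_sub A1c vA1.
rewrite !inE => /eqP mv /eqP mu w' w'S.
apply: (line_close_merges uv w'S _ scale1).
exact: (close_common_neighbour r_ge0 r_irr m_ge0 m_rev m_max mu mv uv rua rva).
Qed.

Lemma timescale_ratio j :
  timescale j.+1 N / alpha N @[N --> \oo] --> 0 ->
  timescale j N / alpha N @[N --> \oo] --> 0.
Proof.
move=> scale; apply: (squeeze_cvgr _ (cvg_cst _) scale).
apply: filterS near_regime => N [N12 d1 r2 _].
have N0 : (0 < N)%N by exact: leq_trans N12.
have dN := d_gt0 N0; have aN := alpha_gt0 N0.
rewrite !divr_ge0 ?exprn_ge0 ?(ltW dN) ?(ltW aN)//=.
rewrite ler_wpM2r ?invr_ge0 ?(ltW aN)// /timescale.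
rewrite [N%:R ^+ _.+1]exprS [d N ^+ j.+2]exprS -mulf_div ler_peMl//.
  by rewrite divr_ge0 ?exprn_ge0 ?(ltW dN).
by rewrite ler_pdivlMr// mul1r (le_trans d1)// ler1n.
Qed.

Lemma sum_star_restrict (D V : {set S}) N x :
  (forall y, y \in Sstar m -> (y \in V) = (y \in D)) ->
  {subset D <= Sstar m} ->
  \sum_(y in Sstar m | y \in V) condensate_prob N x y =
  \sum_(y in D) condensate_prob N x y.
Proof.
move=> VD DS; apply: eq_bigl => y; have [yS|yS] := boolP (y \in Sstar m).
  exact: VD.
by apply/esym/negbTE; apply: contra yS; exact: DS.
Qed.

Lemma rate_gt0_sym x y : 0 < r x y -> 0 < r y x.
Proof.
have mgt0 := stationary_gt0 r_irr m_ge0 m_rev m_max.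
move=> rxy; rewrite -(pmulr_rgt0 _ (mgt0 y)) -m_rev mulr_gt0//.
Qed.

Variables (x : S) (A B : {set S}).
Hypothesis xS : x \in Sstar m.
Hypothesis Ac : A \in comps2 r m.
Hypothesis Bc : B \in comps3 r m.
Hypothesis xA : x \in A.
Hypothesis xB : x \in B.

Lemma before_timescale0 : alpha N / timescale 0 N @[N --> \oo] --> 0 ->
  condensate_prob N x x @[N --> \oo] --> (1 : R).
Proof.
move=> scale; have xx : x \in [set x]%SET by rewrite finset.in_set1.
have := no_escape xS xx (fun _ _ _ _ => leq0n _) scale.
apply: cvg_trans; apply: near_eq_cvg; exists 0%N => // N _.
rewrite (@sum_star_restrict [set x]%SET)//; first by rewrite big_set1.
by move=> y; rewrite finset.in_set1 => /eqP ->.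
Qed.

Lemma between_timescale01 : timescale 0 N / alpha N @[N --> \oo] --> 0 ->
  alpha N / timescale 1 N @[N --> \oo] --> 0 ->
  forall y, y \in A -> condensate_prob N x y @[N --> \oo] --> (#|A|%:R^-1 : R).
Proof.
move=> scale0 scale1; apply: equidistributed => //; first exact: comps2_sub.
  by move=> y z w yA zA; exact: (comps2_merges scale0 Ac yA zA).
have exits u v : u \in A -> v \notin A -> 0 < r u v -> v \in S0 m.
  move=> uA vA ruv; rewrite finset.in_setC; apply: contra vA => vS.
  exact: comps2_closed ruv.
have cross u v : 0 < r u v -> (u \in A) != (v \in A) ->
    (1 <= (u \in S0 m) + (v \in S0 m))%N.
  move=> ruv; have [uA|uA] := boolP (u \in A);
    have [vA|vA] := boolP (v \in A) => // _.
    by rewrite (exits u v)// addn1.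
  by rewrite (exits v u)// rate_gt0_sym.
have := no_escape xS xA cross scale1; apply: cvg_trans; apply: near_eq_cvg.
by exists 0%N => // N _; apply: sum_star_restrict => //; exact: comps2_sub.
Qed.

Lemma between_timescale12 : timescale 1 N / alpha N @[N --> \oo] --> 0 ->
  alpha N / timescale 2 N @[N --> \oo] --> 0 ->
  forall y, y \in B -> condensate_prob N x y @[N --> \oo] --> (#|B|%:R^-1 : R).
Proof.
move=> scale1 scale2; have BS := comps3_sub Bc.
apply: equidistributed => //.
  move=> y z w yB zB; apply: (comps3_merges _ scale1 Bc yB zB).
  exact: timescale_ratio.
(* Adding to [B] its neighbours in [S0] turns all exits into [S0]-[S0] bonds. *)
pose V : {set S} := [set y | (y \in B) ||
  (y \in S0 m) && [exists b in B, 0 < r b y]]%SET.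
have VB y : y \in Sstar m -> (y \in V) = (y \in B).
  by move=> yS; rewrite /V finset.in_set finset.in_setC yS orbF.
have exits u v : u \in V -> v \notin V -> 0 < r u v ->
    (u \in S0 m) && (v \in S0 m).
  move=> uV vV ruv; have vB : v \notin B.
    by apply: contra vV => vB; rewrite /V finset.in_set vB.
  have [uB|uB] := boolP (u \in B).
    case/negP: vV; rewrite /V finset.in_set finset.in_setC.
    have [vS|vS] := boolP (v \in Sstar m).
      by rewrite (comps3_closed Bc uB vS ruv).
    by rewrite orbC; apply/orP; left; apply/exists_inP; exists u.
  move: uV; rewrite /V finset.in_set (negPf uB)/=.
  move=> /andP[uS0 /exists_inP[b bB rbu]].
  rewrite uS0 /= finset.in_setC; apply: contra vB => vS.
  by apply: (comps3_closed2 Bc bB vS uS0 rbu); exact: rate_gt0_sym.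
have cross u v : 0 < r u v -> (u \in V) != (v \in V) ->
    (2 <= (u \in S0 m) + (v \in S0 m))%N.
  move=> ruv; have [uV|uV] := boolP (u \in V);
    have [vV|vV] := boolP (v \in V) => // _.
    by have /andP[-> ->] := exits u v uV vV ruv.
  by have /andP[-> ->] := exits v u vV uV (rate_gt0_sym ruv).
have xV : x \in V by rewrite VB.
have := no_escape xS xV cross scale2; apply: cvg_trans; apply: near_eq_cvg.
by exists 0%N => // N _; exact: sum_star_restrict.
Qed.

Lemma after_timescale2 : timescale 2 N / alpha N @[N --> \oo] --> 0 ->
  forall y, y \in Sstar m ->
    condensate_prob N x y @[N --> \oo] --> (#|Sstar m|%:R^-1 : R).
Proof.
move=> scale; apply: equidistributed => //; last exact: sum_star_cvg.
move=> y z w yS zS wS; have [->|yz] := eqVneq y z; first exact: merges_refl.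
apply: (line_close_merges yz wS _ scale); apply: close_irreducible => //.
  by apply/eqP; rewrite inE in yS.
by apply/eqP; rewrite inE in zS.
Qed.
End Metastability.

(** * The theorem *)

Theorem theorem2p13 (R : realType) (S : finType)
  (r : S -> S -> R) (m : S -> R)
  (r_ge0 : forall x y, 0 <= r x y)
  (r_diag : forall x, r x x = 0)
  (r_irr : irreducible r)
  (m_ge0 : forall x, 0 <= m x)
  (m_stat : stationary r m)
  (m_rev : reversible r m)
  (m_max : (forall x, m x <= 1) /\ (exists x, m x = 1))
  (d : nat -> R)
  (d_gt0 : forall N, (0 < N)%N -> 0 < d N)
  (d_log : d N * ln N%:R @[N --> \oo] --> 0)
  (d_exp : forall eps : R, 0 < eps ->
     d N * expR (eps * N%:R) @[N --> \oo] --> +oo)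
  (disp : nat -> measure_display)
  (Om : forall N, measurableType (disp N))
  (P : forall N, config S N -> probability (Om N) R)
  (eta : forall N, R -> Om N -> config S N)
  (eta_inclusion : forall N, (0 < N)%N ->
     is_markov_chain (inclusion_rate r (d N) (N := N)) (P N) (eta N))
  (alpha : nat -> R)
  (alpha_gt0 : forall N, (0 < N)%N -> 0 < alpha N)
  (x : S) (hx : x \in Sstar m)
  (A B : {set S}) (hA : A \in comps2 r m) (hB : B \in comps3 r m)
  (hxA : x \in A) (hAB : A \subset B) :
  let theta1 := fun N => 1 / d N in
  let theta2 := fun N => N%:R / d N ^+ 2 in
  let theta3 := fun N => N%:R ^+ 2 / d N ^+ 3 in
  let prob := fun y N =>
    P N (xi N x) [set w | eta N (alpha N) w = xi N y] in
  (asym_lt alpha theta1 ->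
     prob x N @[N --> \oo] --> 1%E) /\
  (asym_lt theta1 alpha -> asym_lt alpha theta2 ->
     forall y, y \in A ->
       prob y N @[N --> \oo] --> (#|A|%:R^-1)%:E) /\
  (asym_lt theta2 alpha -> asym_lt alpha theta3 ->
     forall y, y \in B ->
       prob y N @[N --> \oo] --> (#|B|%:R^-1)%:E) /\
  (asym_lt theta3 alpha ->
     forall y, y \in Sstar m ->
       prob y N @[N --> \oo] --> (#|Sstar m|%:R^-1)%:E).
Proof.
move=> theta1 theta2 theta3 prob; have [m_le1 m_ex] := m_max.
have xB : x \in B by exact: (fintype.subsetP hAB).
have probE N (eta0 zeta : config S N) : (0 < N)%N ->
    P N eta0 [set w | eta N (alpha N) w = zeta] =
    (transition (inclusion_rate r (d N) (N := N)) (alpha N) eta0 zeta)%:E.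
  by move=> N0; apply: is_markov_chain_transition (ltW (alpha_gt0 N N0));
    exact: eta_inclusion.
have trans_ge0 N (eta0 zeta : config S N) : (0 < N)%N ->
    0 <= transition (inclusion_rate r (d N) (N := N)) (alpha N) eta0 zeta.
  by move=> N0; rewrite -lee_fin -probE.
have prob_cvg y (l : R) : condensate_prob r d alpha N x y @[N --> \oo] --> l ->
    prob y N @[N --> \oo] --> l%:E.
  move=> hop_l; have : (condensate_prob r d alpha N x y)%:E @[N --> \oo] --> l%:E.
    by apply: cvg_EFin => //; exact: nearW.
  apply: cvg_trans; apply: near_eq_cvg; exists 1%N => // N N1.
  by rewrite /prob probE.
have th1 : theta1 = timescale d 0.
  by apply/funext => N; rewrite /theta1 /timescale expr0 expr1.
have th2 : theta2 = timescale d 1.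
  by apply/funext => N; rewrite /theta2 /timescale expr1.
rewrite th1 th2 (_ : theta3 = timescale d 2) // /asym_lt.
split.
  by move=> scale; apply: prob_cvg; apply: (@before_timescale0 _ _ r m).
split.
  move=> scale0 scale1 y yA; apply: prob_cvg.
  by apply: (@between_timescale01 _ _ r m).
split.
  move=> scale1 scale2 y yB; apply: prob_cvg.
  by apply: (@between_timescale12 _ _ r m).
move=> scale y yS; apply: prob_cvg.
by apply: (@after_timescale2 _ _ r m).
Qed.
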